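(* Let $\omega:[0,1]\to\mathbb{R}$ be continuous (and nonconstant), with associated tree $\mathbb{T}$ and length measure $\lambda$; notation is as in the context. (a) For a bounded function $\rho:[0,1]\to\mathbb{R}$, the integrability condition $\int_{\mathbb{T}}|\Delta\rho(\tau)|\,\lambda(d\tau)<\infty$ holds as soon as $1/\mathcal{V}(\omega)+1/\mathcal{V}(\rho|\omega)>1$. (b) Let $p,q\ge1$ with $1/p+1/q>1$, and let $\omega$ be fixed with $V_p(\omega)<\infty$. Then the space $\mathbb{B}_{q,\omega}$ of bounded functions $\rho$ on $[0,1]$ such that $V_q(\rho|\omega)<\infty$ is a Banach space for the norm $$\|\rho\|_{q,\omega}:=V_q(\rho|\omega)^{1/q}+\sup|\rho|,$$ and, for some $C=C(p,q)$, one has for $\rho\in\mathbb{B}_{q,\omega}$ $$V_q\Bigl(\int_0^{\cdot}\rho\,d\omega\Bigm|\omega\Bigr)^{1/q}\le C\,V_p(\omega)^{1/p}\,V_q(\rho|\omega)^{1/q},$$ $$\Bigl\|\int_0^{\cdot}\rho\,d\omega\Bigr\|_{q,\omega}+V_p\Bigl(\int_0^{\cdot}\rho\,d\omega\Bigr)^{1/p}\le C\,V_p(\omega)^{1/p}\,\|\rho\|_{q,\omega}.$$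
   Context: For a continuous nonconstant $\omega:[0,1]\to\mathbb{R}$, put $\delta(s,t)=\omega(s)+\omega(t)-2\inf_{[s,t]}\omega$ ($[s,t]$ denotes the interval with endpoints $s,t$). This is a semi-distance on $[0,1]$; the quotient metric space $\mathbb{T}=([0,1]/\delta,\delta)$ is a compact real tree, i.e. any two points $\tau_1,\tau_2$ are joined by a unique arc $[\tau_1,\tau_2]$, isometric to $[0,\delta(\tau_1,\tau_2)]$. Let $\pi:[0,1]\to\mathbb{T}$ be the projection, $O=\pi(U)$ where $U$ is a time at which $\omega$ attains its minimum, $A=\pi(0)$, $B=\pi(1)$; one has $O\in[A,B]$. The tree is rooted at $O$; a leaf is a point $\tau$ such that $\tau\notin[O,\sigma]$ for all $\sigma\neq\tau$. The length measure $\lambda$ is the unique measure on $\mathbb{T}$ for which the set of leaves has measure zero and the measure of each arc is its length. Put $\tau^\nearrow=\inf\pi^{-1}(\tau)$, $\tau^\nwarrow=\sup\pi^{-1}(\tau)$, and $\Delta\rho(\tau)=\rho(\tau^\nearrow)-\rho(\tau^\nwarrow)$, with the convention that $\rho(\tau^\nearrow)$ is replaced by $0$ for $\tau\in[O,A]$ and $\rho(\tau^\nwarrow)$ is replaced by $0$ for $\tau\in[O,B]$. When $\int_{\mathbb{T}}|\Delta\rho|\,d\lambda<\infty$, one defines $\int_0^1\rho\,d\omega=\int_{\mathbb{T}}\Delta\rho\,d\lambda$; $\int_s^t\rho\,d\omega$ is defined in the same way with $\rho$ replaced by $\rho1_{(s,t]}$, and $\int_0^{\cdot}\rho\,d\omega$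 is the function $t\mapsto\int_0^t\rho\,d\omega$ on $[0,1]$. For $p\ge1$, $V_p(f)=\sup\sum_i|f(t_{i+1})-f(t_i)|^p$ over subdivisions $(t_i)$ of $[0,1]$, and $\mathcal{V}(f)=\inf\{p\ge1:V_p(f)<\infty\}$. For $q\ge1$, $$V_q(\rho|\omega)=\sup\sum_k|\rho(t_{2k+2})-\rho(t_{2k+1})|^q,$$ the supremum being over subdivisions $(t_i)$ of $[0,1]$ such that $\omega(t_{2k+1})=\omega(t_{2k+2})$ for all $k$; and $\mathcal{V}(\rho|\omega)=\inf\{q\ge1:V_q(\rho|\omega)<\infty\}$.
   Formalization: In the estimates of (b), Δ(ρ1_(0,t]) is assumed Borel measurable on the tree for every t, since otherwise the integral of ρ against ω is undefined (for tent-shaped ω every bounded ρ, measurable or not, lies in the space). *)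

(* Defs.v *)
From HB Require Import structures.
From mathcomp Require Import all_boot all_order all_algebra generic_quotient.
From mathcomp Require Import all_classical all_reals all_analysis.
From mathcomp Require Import lra.

Set Implicit Arguments.
Unset Strict Implicit.
Unset Printing Implicit Defensive.

Import Order.TTheory GRing.Theory Num.Theory.
Import numFieldNormedType.Exports.

Local Open Scope classical_set_scope.
Local Open Scope ring_scope.
Local Open Scope quotient_scope.

(* The library gives this type the topology induced by R. *)
Notation unit_itv R := (set_type (`[(0 : R), (1 : R)]%classic : set R)).

Lemma in_itv0 (R : realType) : (0 : R) \in (`[(0 : R), (1 : R)]%classic : set R).
Proof. by rewrite inE /= in_itv /= lexx ler01. Qed.

Lemma in_itv1 (R : realType) : (1 : R) \in (`[(0 : R), (1 : R)]%classic : set R).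
Proof. by rewrite inE /= in_itv /= lexx ler01. Qed.

Definition time0 (R : realType) : unit_itv R := SigSub (in_itv0 R).
Definition time1 (R : realType) : unit_itv R := SigSub (in_itv1 R).

Section delta.
Context {R : realType}.
Local Notation I := (unit_itv R).
Implicit Types (w : continuousType I R) (s t u : I).

Definition between s t : set I :=
  [set u | Num.min (val s) (val t) <= val u <= Num.max (val s) (val t)].

Definition delta w s t : R := w s + w t - 2 * inf [set w u | u in between s t].

Lemma between_refl s t : between s t s.
Proof. by rewrite /between /= ge_min lexx le_max lexx. Qed.

Lemma betweenC s t : between s t = between t s.
Proof. by rewrite /between minC maxC. Qed.

Lemma between_split s t u v : between s u v -> between s t v \/ between t u v.
Proof.
rewrite /between /= !ge_min !le_max => /andP[/orP[]h1 /orP[]h2];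
  by have [h|/ltW h] := leP (val v) (val t);
  rewrite ?h ?h1 ?h2 ?orbT /=; auto.
Qed.

Lemma path_lbounded w : exists m : R, forall t, m <= w t.
Proof.
have cw : {within `[(0 : R), (1 : R)]%classic, continuous (valL_ (0 : R) w)}.
  by apply/subspace_valL_continuousP'; exact: cts_fun.
have [c _ cmin] := EVT_min ler01 cw.
exists (valL_ (0 : R) w c) => t.
have := cmin (set_val t).
have -> : valL_ (0 : R) w (set_val t) = w t.
  by rewrite /valL_ /= /oapp /= oinv_set_val set_valE valK.
by move=> /(_ (set_valP t)).
Qed.

Lemma path_inf_le w s t u : between s t u ->
  inf [set w u | u in between s t] <= w u.
Proof.
move=> stu; apply: ge_inf; last by exists u.
by have [m wm] := path_lbounded w; exists m => _ [v _ <-].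
Qed.

Lemma delta_ge0 w s t : 0 <= delta w s t.
Proof.
have := path_inf_le w (between_refl s t).
have : between s t t by rewrite betweenC; exact: between_refl.
by move=> /(path_inf_le w); rewrite /delta; lra.
Qed.

Lemma deltaxx w s : delta w s s = 0.
Proof.
rewrite /delta; suff -> : [set w u | u in between s s] = [set w s].
  by rewrite inf1; lra.
apply/seteqP; split=> [_ [v + <-]|_ ->]; last by exists s => //; exact: between_refl.
rewrite /between /= minxx maxxx => sv /=; congr (w _); apply: val_inj.
by apply/eqP; rewrite eq_le andbC.
Qed.

Lemma deltaC w s t : delta w s t = delta w t s.
Proof. by rewrite /delta betweenC (addrC (w s)). Qed.

Lemma delta_triangle w t s u : delta w s u <= delta w s t + delta w t u.
Proof.
have st : between s t t by rewrite betweenC; exact: between_refl.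
have h1 := path_inf_le w st.
have h2 := path_inf_le w (between_refl t u).
rewrite /delta.
suff : Num.min (inf [set w v | v in between s t])
   (inf [set w v | v in between t u]) <= inf [set w v | v in between s u].
  by rewrite ge_min => /orP[]; lra.
apply: lb_le_inf; first by exists (w s), s => //; exact: between_refl.
move=> _ [v /(between_split t) [] /(path_inf_le w) hv <-];
  by rewrite ge_min hv ?orbT.
Qed.

Lemma delta_eqv w :
  equiv_class_of (fun s t : I => delta w s t == 0).
Proof.
split=> [s|s t|t s u]; first by rewrite deltaxx.
  by rewrite deltaC.
move=> /eqP st /eqP tu; rewrite eq_le delta_ge0 andbT.
by rewrite (le_trans (delta_triangle w t s u))// st tu addr0.
Qed.

Canonical delta_equiv w : equiv_rel I := EquivRelPack (delta_eqv w).

Definition tree w := {eq_quot (delta_equiv w)}.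

End delta.

HB.instance Definition _ (R : realType) (w : continuousType (unit_itv R) R) :=
  Choice.on (tree w).
HB.instance Definition _ (R : realType) (w : continuousType (unit_itv R) R) :=
  EqQuotient.on (tree w).

Definition tree_proj (R : realType) (w : continuousType (unit_itv R) R)
  (t : unit_itv R) : tree w := \pi_(tree w) t.

Section tree_metric.
Context {R : realType} (w : continuousType (unit_itv R) R).

Definition tree_dist (x y : tree w) : R := delta w (repr x) (repr y).

Let distxx x : tree_dist x x = 0.
Proof. exact: deltaxx. Qed.

Let dist_positivity x y : tree_dist x y = 0 -> x = y.
Proof.
move=> /eqP xy; rewrite -[x]reprK -[y]reprK.
by apply/eqquotP.
Qed.

Let dist_sym x y : tree_dist x y = tree_dist y x.
Proof. exact: deltaC. Qed.

Let dist_triangle y x z : tree_dist x z <= tree_dist x y + tree_dist y z.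
Proof. exact: delta_triangle. Qed.

HB.instance Definition _ := @isMetric.Build R (tree w) tree_dist
  distxx dist_positivity dist_sym dist_triangle.

HB.instance Definition _ := isPointed.Build (tree w) (tree_proj w (time0 R)).

Lemma mdist_tree_proj s t : mdist (tree_proj w s) (tree_proj w t) = delta w s t.
Proof.
have E u : delta w (repr (tree_proj w u)) u = 0.
  by apply/eqP/(@eqquotP _ _ (tree w)); rewrite reprK.
rewrite /mdist /= /tree_dist; apply/eqP; rewrite eq_le; apply/andP; split.
  rewrite (le_trans (delta_triangle w s _ _))// E add0r.
  by rewrite (le_trans (delta_triangle w t _ _))// (deltaC w t) E addr0.
rewrite (le_trans (delta_triangle w (repr (tree_proj w s)) _ _))// (deltaC w s) E add0r.
by rewrite (le_trans (delta_triangle w (repr (tree_proj w t)) _ _))// E addr0.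
Qed.

End tree_metric.

(* The points of M lying on a geodesic from a to b.  In a real tree there is
   only one such geodesic, and this is the arc [a, b]. *)
Definition tree_arc (R : realType) (M : metricType R) (a b : M) : set M :=
  [set c | exists g : R -> M,
    [/\ g 0 = a, g (mdist a b) = b,
        {in `[0, mdist a b] &, forall x y, mdist (g x) (g y) = `|x - y|} &
        exists2 x, x \in `[0, mdist a b] & g x = c]].

Definition leaves (R : realType) (M : metricType R) (O : M) : set M :=
  [set a | forall b, b <> a -> ~ tree_arc O b a].

Notation borel_tree w := (g_sigma_algebraType (@open (tree w))).

Section tree_integral.
Context {R : realType} (w : continuousType (unit_itv R) R).
Local Notation I := (unit_itv R).

Definition is_min_time (U : I) := forall t, w U <= w t.

Definition is_length_measure (O : tree w)
    (lambda : {measure set (borel_tree w) -> \bar R}) :=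
  lambda (leaves O) = 0%E /\
  forall a b : tree w, lambda (tree_arc a b) = (mdist a b)%:E.

(* The default value of insubd is never used: classes are nonempty subsets of
   [0, 1]. *)
Definition first_time (tau : tree w) : I :=
  insubd (time0 R) (inf [set val t | t in tree_proj w @^-1` [set tau]]).

Definition last_time (tau : tree w) : I :=
  insubd (time0 R) (sup [set val t | t in tree_proj w @^-1` [set tau]]).

Definition Drho (O : tree w) (rho : I -> R) (tau : tree w) : R :=
  (if tau \in tree_arc O (tree_proj w (time0 R)) then 0 else rho (first_time tau)) -
  (if tau \in tree_arc O (tree_proj w (time1 R)) then 0 else rho (last_time tau)).

Definition restr_itv (s t : I) (rho : I -> R) : I -> R :=
  fun u => if val s < val u <= val t then rho u else 0.

(* Meaningful only when the integrand is lambda-integrable. *)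
Definition tree_int (O : tree w)
    (lambda : {measure set (borel_tree w) -> \bar R}) (rho : I -> R)
    (s t : I) : R :=
  \int[lambda]_tau Drho O (restr_itv s t rho) tau.

End tree_integral.

Section variations.
Context {R : realType}.
Local Notation I := (unit_itv R).

(* A subdivision is t 0 <= ... <= t n in [0, 1]; neither strictness nor
   t 0 = 0, t n = 1 is imposed.  This is immaterial in Vp, and in Vcond it lets
   the pairs start at time 0. *)
Definition subdivision (t : nat -> I) :=
  forall i j : nat, (i <= j)%N -> val (t i) <= val (t j).

Definition Vp (p : R) (f : I -> R) : \bar R :=
  ereal_sup [set x | exists n (t : nat -> I), subdivision t /\
    x = (\sum_(i < n) `|f (t i.+1) - f (t i)| `^ p)%:E].

Definition Vcond (q : R) (rho w : I -> R) : \bar R :=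
  ereal_sup [set x | exists n (t : nat -> I), [/\ subdivision t,
    forall k, (k < n)%N -> w (t k.*2.+1) = w (t k.*2.+2) &
    x = (\sum_(k < n) `|rho (t k.*2.+2) - rho (t k.*2.+1)| `^ q)%:E]].

Definition var_index (f : I -> R) : \bar R :=
  ereal_inf [set p%:E | p in [set p : R | 1 <= p /\ (Vp p f < +oo)%E]].

Definition cond_var_index (rho w : I -> R) : \bar R :=
  ereal_inf [set q%:E | q in [set q : R | 1 <= q /\ (Vcond q rho w < +oo)%E]].

Definition Bspace (q : R) (w : I -> R) : set (I -> R) :=
  [set rho | bounded_fun rho /\ (Vcond q rho w < +oo)%E].

Definition Bnorm (q : R) (w rho : I -> R) : \bar R :=
  (Vcond q rho w `^ q^-1 + ereal_sup [set `|rho t|%:E | t in [set: I]])%E.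

End variations.

(* X, with the pointwise operations and the norm N, is a Banach space. *)
Definition is_Banach_space (R : realType) (T : Type) (X : set (T -> R))
    (N : (T -> R) -> \bar R) : Prop :=
  exists (B : completeNormedModType R) (ev : {linear B -> (T -> R)}),
    [/\ injective ev, range ev = X & forall b : B, `|b|%:E = N (ev b)].

(* Main.v *)
From HB Require Import structures.
Require Import Defs.
From mathcomp Require Import all_boot all_order all_algebra.
From mathcomp Require Import all_classical all_reals all_analysis.
From mathcomp Require Import measurable_realfun ring lra.

(** Above a point [tau] of the tree lies a subtree, traversed by the path during a time
    interval whose two ends carry the value [lev tau]; [Drho] compares [rho] at these
    ends.  Group the points by the height of their subtree, on a dyadic scale.  For the
    points of height between [e] and [2 * e] whose levels agree modulo [2 * e], the time
    intervals are disjoint, so that there are at most [V_p(w) / e ^ p] of them and their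
    ends form an admissible family for [V_q(rho | w)]; Hoelder's inequality bounds the sum
    of [|Drho|] over them.  Integrating over the level modulo [2 * e], and then summing over
    the dyadic scale, gives a geometric series which converges because [1/p + 1/q > 1].

    The same bound on a time interval [[s, t]] controls the increment of the integral from
    [s] to [t], apart from the points of the arc joining [s] to [t].  On this arc [Drho] is
    bounded by [2 * sup |rho|]; when [w s = w t], the two branches of the arc cover the
    same levels, and at each level the two contributions add up to an increment of [rho]
    between times with the same value of [w].  Summing over intervals uses that the
    variations are superadditive. *)

Set Implicit Arguments.
Unset Strict Implicit.
Unset Printing Implicit Defensive.

Import Order.TTheory GRing.Theory Num.Theory.
Import numFieldNormedType.Exports.

Local Open Scope classical_set_scope.
Local Open Scope ring_scope.

(** * Times and ancestors *)

(** A band of heights contains a continuum of points, so an estimate of finite sums has to become an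
    estimate of an integral. This works because the length measure lives on the skeleton, a
    countable union of arcs on each of which it is Lebesgue measure in the level: once the level is
    fixed modulo [2 * e], at most countably many points remain, and every finite set of them obeys
    the combinatorial estimate. With [M] for [V_p ^ (1/p)], [Q] for [V_q] and [e = M / 2 ^ (j + 1)],
    at most [N = 2 ^ ((j + 1) p)] intervals contribute, with a sum of order
    [N ^ (1 - 1/q) Q ^ (1/q)]; the period [2 * e] of the levels multiplies it, whence the ratio
    [2 ^ (p (1 - 1/q) - 1)]. Arcs, subtrees and branch points are all read off one relation on
    times: [v] is an ancestor of [s] when [w] is at least [w v] between them. In each bound on an
    increment over [[s, t]], only one of the two variations is localized to [[s, t]]; the other
    stays global and acts as a constant, so that superadditivity applies to a single factor. *)

Section times.
Context {R : realType}.
Local Notation I := (unit_itv R).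
Implicit Types s t u v : I.

(* A locked-down name for [val]: simplification would turn [val] into [sval], and
   [lra] does not identify the two. *)
Definition time (s : I) : R := val s.
Arguments time : simpl never.

Lemma time_inj : injective time.
Proof. exact: val_inj. Qed.

Lemma time_ge0 s : 0 <= time s.
Proof. by rewrite /time; have := valP s; rewrite inE /= in_itv /= => /andP[]. Qed.

Lemma time_le1 s : time s <= 1.
Proof. by rewrite /time; have := valP s; rewrite inE /= in_itv /= => /andP[]. Qed.

Lemma mem_unit_itv (x : R) : 0 <= x <= 1 ->
  x \in (`[(0 : R), (1 : R)]%classic : set R).
Proof. by move=> x01; rewrite inE /= in_itv. Qed.

Lemma time_exists (x : R) : 0 <= x <= 1 -> exists s, time s = x.
Proof. by move=> /mem_unit_itv x01; exists (SigSub x01). Qed.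

Lemma betweenP s t u : between s t u <->
  (time s <= time u <= time t) \/ (time t <= time u <= time s).
Proof.
rewrite /between /= -!/(time _) ge_min le_max; split.
  by have [h|h] := leP (time s) (time t); move=> /andP[/orP[]h1 /orP[]h2];
     (left; apply/andP; split; lra) || (right; apply/andP; split; lra).
by move=> [|] /andP[-> ->]; rewrite ?orbT.
Qed.

Lemma between_le s t u : time s <= time t -> between s t u <-> time s <= time u <= time t.
Proof.
move=> st; rewrite betweenP; split; last by left.
by case=> // /andP[tu us]; apply/andP; split; lra.
Qed.

End times.

Section ancestor.
Context {R : realType} (w : continuousType (unit_itv R) R).
Local Notation I := (unit_itv R).
Implicit Types s t u v c : I.

Lemma valL_time (f : I -> R) t : valL_ (0 : R) f (time t) = f t.
Proof.
by rewrite -[time t]/(set_val t) /valL_ /= /oapp /= oinv_set_val set_valE valK.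
Qed.

Lemma path_continuous s (e : R) : 0 < e ->
  exists2 d : R, 0 < d & forall t, `|time t - time s| < d -> `|w t - w s| < e.
Proof.
move=> e0.
have cw : {within `[(0 : R), (1 : R)]%classic, continuous (valL_ (0 : R) w)}.
  by apply/subspace_valL_continuousP'; exact: cts_fun.
have sI : `[(0 : R), (1 : R)]%classic (time s) by have := valP s; rewrite inE.
move/subspace_continuousP : cw => /(_ _ sI) /cvgrPdist_lt /(_ _ e0).
rewrite near_withinE => /nbhs_ballP[d /= d0 hd]; exists d => // t std.
have := hd (time t); rewrite /ball /= distrC => /(_ std).
have tI : `[(0 : R), (1 : R)]%classic (time t) by have := valP t; rewrite inE.
move=> /(_ tI). rewrite -(valL_time w t) -(valL_time w s) distrC. exact.
Qed.

(** Equivalent to: the class of [v] lies on the arc from the root to the class of [s]. This order on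
    times replaces geodesics in most arguments. *)
Definition anc v s := forall u, between v s u -> w v <= w u.

Lemma anc_refl s : anc s s.
Proof.
move=> u /betweenP us; have -> // : u = s.
by apply: time_inj; apply/eqP; rewrite eq_le; case: us => /andP[-> ->].
Qed.

Lemma anc_le v s : anc v s -> w v <= w s.
Proof. by apply; rewrite betweenC; exact: between_refl. Qed.

Lemma anc_trans u v s : anc u v -> anc v s -> anc u s.
Proof.
move=> uv vs x /(between_split v)[/uv//|/vs]; apply: le_trans; exact: anc_le.
Qed.

(** This is the tree property: the ancestors of one time are linearly ordered by their level, since
    a time between [u] and [v] is between [u] and [s] or between [s] and [v]. *)
Lemma anc_chain u v s : anc u s -> anc v s -> w u <= w v -> anc u v.
Proof.
move=> us vs uv x /(between_split s)[/us//|]; rewrite betweenC => /vs.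
exact: le_trans.
Qed.

Lemma inf_between_anc v s : anc v s -> inf [set w u | u in between v s] = w v.
Proof.
move=> vs; apply/eqP; rewrite eq_le; apply/andP; split.
  by apply: path_inf_le; exact: between_refl.
apply: lb_le_inf; first by exists (w v), v => //; exact: between_refl.
by move=> _ [u /vs ? <-].
Qed.

Lemma delta_ancP v s : anc v s <-> delta w v s = w s - w v.
Proof.
split=> [/inf_between_anc h|h u /(path_inf_le w)]; first by rewrite /delta h; lra.
by apply: le_trans; move: h; rewrite /delta; lra.
Qed.

Lemma delta_ge v s : w s - w v <= delta w v s.
Proof.
have := path_inf_le w (between_refl v s); rewrite /delta.
lra.
Qed.

Lemma delta_eq0P v s : delta w v s = 0 <-> anc v s /\ anc s v.
Proof.
split=> [h|[vs sv]].
  have := delta_ge v s; have := delta_ge s v; rewrite (deltaC w s) h => h1 h2.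
  by split; apply/delta_ancP; rewrite ?(deltaC w s) h; lra.
have := anc_le sv; have := anc_le vs.
move/delta_ancP : vs; lra.
Qed.

Lemma anc_level_eq u v s : anc u s -> anc v s -> w u = w v -> delta w u v = 0.
Proof.
by move=> us vs uv; apply/delta_eq0P; split;
  [apply: (anc_chain us vs)|apply: (anc_chain vs us)]; rewrite uv.
Qed.

Lemma delta_chain u v s : anc u s -> anc v s -> delta w u v = `|w u - w v|.
Proof.
move=> us vs; have [uv|/ltW vu] := leP (w u) (w v).
  have /delta_ancP -> := anc_chain us vs uv.
  by rewrite ler0_norm ?opprB// subr_le0.
by rewrite deltaC; have /delta_ancP -> := anc_chain vs us vu; rewrite ger0_norm ?subr_ge0.
Qed.

(** Intermediate value theorem that selects an ancestor: on the way from [s] to [c], [u] is the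
    place where the path is about to drop below [a], so the path stays above [a] between [s] and
    [u]. *)
Lemma descent s c (a : R) : w c <= a <= w s ->
  exists u, [/\ between s c u, w u = a & anc u s].
Proof.
move=> /andP[ca sa].
have [sc|sc] := eqVneq (time s) (time c).
  have {}sc : s = c by exact: time_inj.
  exists s; split; [exact: between_refl|rewrite -sc in ca; lra|exact: anc_refl].
have s0 := time_ge0 s; have s1 := time_le1 s.
have c0 := time_ge0 c; have c1 := time_le1 c.
(* [z x] is the time at the fraction [x] of the way from [s] to [c]; both orders of [s] and [c] are
   treated at once. Its value for [x] outside [[0, 1]] is arbitrary. *)
have zP x : exists u, 0 <= x <= 1 -> time u = time s + x * (time c - time s).
  case: (boolP (0 <= x <= 1)) => [/andP[x0 x1]|_]; last by exists s.
  by have [|u <-] := @time_exists _ (time s + x * (time c - time s)); [nra|exists u].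
have [z {}zP] := choice zP.
have zd x y : 0 <= x <= 1 -> 0 <= y <= 1 -> `|time (z x) - time (z y)| <= `|x - y|.
  move=> hx hy; rewrite zP// zP// opprD addrACA subrr add0r -mulrBl normrM.
  by apply: ler_piMr => //; rewrite ler_norml; apply/andP; split; lra.
have F0 : z 0 = s by apply: time_inj; rewrite zP ?lexx ?ler01// mul0r addr0.
have F1 : z 1 = c by apply: time_inj; rewrite zP ?lexx ?ler01// mul1r; lra.
(* [sup A] is the fraction up to which the path stays at or above [a]. *)
pose A := [set x | 0 <= x <= 1 /\ forall y, 0 <= y <= x -> a <= w (z y)].
have A0 : A 0.
  split; rewrite ?lexx ?ler01// => y y0; suff -> : y = 0 by rewrite F0.
  by apply/eqP; rewrite eq_le andbC.
have hA : has_sup A by split; [exists 0|exists 1 => x [/andP[]]].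
pose x := sup A.
have x0 : 0 <= x by apply: ub_le_sup => //; exact: hA.2.
have x1 : x <= 1 by apply: ge_sup; [exact: hA.1|move=> y [/andP[]]].
have x01 : 0 <= x <= 1 by rewrite x0.
have ltA y : 0 <= y < x -> a <= w (z y).
  move=> /andP[y0 yx]; have [|x' Ax' x'y] := @sup_adherent _ A (x - y) _ hA.
    by rewrite subr_gt0.
  apply: Ax'.2; rewrite y0/=; apply: ltW; apply: le_lt_trans x'y.
  by rewrite /x; lra.
have Fge : a <= w (z x).
  rewrite leNgt; apply/negP => xa.
  have xgt0 : 0 < x.
    by rewrite lt_neqAle x0 andbT; apply/eqP => E; move: xa; rewrite -E F0; lra.
  have [|d d0 hd] := @path_continuous (z x) (a - w (z x)); first by rewrite subr_gt0.
  pose y := Num.max 0 (x - d / 2).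
  have y0 : 0 <= y by rewrite le_max lexx.
  have yx : y < x by rewrite gt_max xgt0/=; lra.
  have yd : x - y < d by rewrite ltrBlDl -ltrBlDr lt_max; apply/orP; right; lra.
  have /hd : `|time (z y) - time (z x)| < d.
    apply: le_lt_trans (zd _ _ _ _) _ => //; first by rewrite y0; lra.
    by rewrite ltr0_norm ?subr_lt0// opprB.
  have := ltA y; rewrite y0 yx => /(_ isT) h.
  by rewrite ltr_norml => /andP[_]; lra.
have Fle : w (z x) <= a.
  rewrite leNgt; apply/negP => xa.
  have xlt1 : x < 1.
    by rewrite lt_neqAle x1 andbT; apply/eqP => E; move: xa; rewrite E F1; lra.
  have [|d d0 hd] := @path_continuous (z x) (w (z x) - a); first by rewrite subr_gt0.
  pose y := Num.min 1 (x + d / 2).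
  have xy : x < y by rewrite lt_min xlt1/=; lra.
  have y1 : y <= 1 by rewrite ge_min lexx.
  have yd : y - x < d by rewrite ltrBlDl gt_min; apply/orP; right; lra.
  suff : A y by move=> /(ub_le_sup hA.2); rewrite leNgt xy.
  split; first by apply/andP; split => //; lra.
  move=> v /andP[v0 vy]; have [vx|xv] := ltP v x; first by apply: ltA; rewrite v0.
  have /hd : `|time (z v) - time (z x)| < d.
    apply: le_lt_trans (zd _ _ _ _) _ => //; first by rewrite v0; lra.
    by move: vy yd; rewrite ger0_norm ?subr_ge0//; clear; lra.
  by rewrite ltr_norml => /andP[+ _]; clear; lra.
exists (z x); split.
- by apply/betweenP; rewrite zP//; have [sc'|sc'] := leP (time s) (time c);
    [left|right]; apply/andP; split; move: sc' x0 x1; clear; nra.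
- by apply/eqP; rewrite eq_le Fle.
- move=> v; have [vs _|vs] := eqVneq v s.
    by rewrite vs (le_trans Fle).
  have cs0 : time c - time s != 0 by rewrite subr_eq0 eq_sym.
  pose y := (time v - time s) / (time c - time s).
  have ycs : y * (time c - time s) = time v - time s by rewrite /y divfK.
  move=> /betweenP; rewrite zP// => h.
  have /andP[y0 yx] : 0 <= y <= x.
    move: cs0; rewrite neq_lt => /orP[] cs0; apply/andP; split.
    - rewrite -(nmulr_lle0 _ cs0) ycs.
      have : x * (time c - time s) <= 0 by move: x0 cs0; clear; nra.
      by case: h => /andP[]; clear; lra.
    - rewrite -(ler_nM2r cs0) ycs.
      have : x * (time c - time s) <= 0 by move: x0 cs0; clear; nra.
      by case: h => /andP[]; clear; lra.
    - rewrite -(pmulr_lge0 _ cs0) ycs.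
      have : 0 <= x * (time c - time s) by move: x0 cs0; clear; nra.
      by case: h => /andP[]; clear; lra.
    - rewrite -(ler_pM2r cs0) ycs.
      have : 0 <= x * (time c - time s) by move: x0 cs0; clear; nra.
      by case: h => /andP[]; clear; lra.
  have -> : v = z y by apply: time_inj; rewrite zP ?ycs; [clear; lra|by rewrite y0 (le_trans yx)].
  apply: (le_trans Fle); move: yx; rewrite le_eqVlt => /orP[/eqP ->//|yx].
  by apply: ltA; rewrite y0.
Qed.

Lemma anc_level c s (a : R) : anc c s -> w c <= a <= w s ->
  exists u, [/\ w u = a, anc u s & anc c u].
Proof.
move=> cs /[dup] ac /descent[u [_ ua us]]; exists u; split => //.
by apply: (anc_chain cs us); rewrite ua; case/andP: ac.
Qed.

(** A minimum of [w] between [s] and [t] projects to the branch point of the two classes: the arc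
    joining them consists of the two arcs going up from it. *)
Lemma between_argmin s t : exists c, [/\ between s t c, anc c s & anc c t].
Proof.
wlog st : s t / time s <= time t => [wl|].
  have [/wl//|/ltW/wl[c [stc ct cs]]] := leP (time s) (time t).
  by exists c; split => //; rewrite betweenC.
have cw : {within `[time s, time t]%classic, continuous (valL_ (0 : R) w)}.
  apply: (@continuous_subspaceW _ _ _ `[(0 : R), (1 : R)]%classic).
    by apply: subset_itv; rewrite bnd_simp ?time_ge0 ?time_le1.
  by apply/subspace_valL_continuousP'; exact: cts_fun.
have [x xst xmin] := EVT_min st cw.
move: xst; rewrite in_itv/= => /andP[sx xt].
have [|c cx] := @time_exists _ x; first by have := time_ge0 s; have := time_le1 t; lra.
have cst u : time s <= time u <= time t -> w c <= w u.
  by move=> stu; rewrite -(valL_time w c) -(valL_time w u) cx; apply: xmin; rewrite in_itv.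
exists c; split; first by rewrite between_le// cx sx xt.
  by move=> u; rewrite betweenC between_le cx// => /andP[su uc]; apply: cst; lra.
by move=> u; rewrite between_le cx// => /andP[su uc]; apply: cst; lra.
Qed.

End ancestor.

(** * Arcs and geodesics *)

Section tree_geometry.
Context {R : realType} (w : continuousType (unit_itv R) R).
Local Notation I := (unit_itv R).
Local Notation proj := (tree_proj w).
Implicit Types (s t u v c : I) (x y tau : tree w).

Lemma proj_surj tau : exists v, tau = proj v.
Proof. by exists (repr tau); rewrite /tree_proj reprK. Qed.

Lemma proj_eqP s t : proj s = proj t <-> delta w s t = 0.
Proof.
rewrite -mdist_tree_proj; split => [->|]; first exact: mdistxx.
exact: mdist_positivity.
Qed.

Lemma proj_ancP s t : proj s = proj t <-> anc w s t /\ anc w t s.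
Proof. by rewrite proj_eqP delta_eq0P. Qed.

Definition lev tau : R := w (repr tau).

Lemma repr_proj s : proj (repr (proj s)) = proj s.
Proof. by rewrite /tree_proj reprK. Qed.

Lemma lev_proj s : lev (proj s) = w s.
Proof.
have /proj_ancP[/anc_le h1 /anc_le h2] := repr_proj s.
by apply/eqP; rewrite eq_le h1.
Qed.

Definition tanc tau s := anc w (repr tau) s.

Lemma tanc_proj v s : tanc (proj v) s <-> anc w v s.
Proof.
have /proj_ancP[h1 h2] := repr_proj v.
by split; [exact: anc_trans h2|exact: anc_trans h1].
Qed.

Lemma lev_dist x y : `|lev x - lev y| <= mdist x y.
Proof.
have [s ->] := proj_surj x; have [t ->] := proj_surj y.
rewrite !lev_proj mdist_tree_proj ler_norml.
have h1 := delta_ge w s t; have h2 := delta_ge w t s.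
by rewrite (deltaC w t) in h2; apply/andP; split; move: h1 h2; clear; lra.
Qed.

Lemma tanc_level_inj x y s : tanc x s -> tanc y s -> lev x = lev y -> x = y.
Proof.
have [u ->] := proj_surj x; have [v ->] := proj_surj y.
rewrite !tanc_proj !lev_proj => us vs uv; apply/proj_eqP; exact: anc_level_eq us vs uv.
Qed.

Lemma tanc_dist x y s : tanc x s -> tanc y s -> mdist x y = `|lev x - lev y|.
Proof.
have [u ->] := proj_surj x; have [v ->] := proj_surj y.
by rewrite !tanc_proj !lev_proj mdist_tree_proj; exact: delta_chain.
Qed.

Definition clamp (L y : R) : R := Num.max 0 (Num.min y L).

Lemma clamp_id (L y : R) : 0 <= y <= L -> clamp L y = y.
Proof. by move=> /andP[y0 yL]; rewrite /clamp (min_idPl _)// (max_idPr _). Qed.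

Lemma clamp_itv (L y : R) : 0 <= L -> 0 <= clamp L y <= L.
Proof. by move=> L0; rewrite /clamp le_max lexx/= ge_max L0/= ge_min lexx orbT. Qed.

Lemma clamp_lip (L x y : R) : `|clamp L x - clamp L y| <= `|x - y|.
Proof.
have minL a b : `|Num.min a L - Num.min b L| <= `|a - b|.
  by have [?|?] := leP a L; have [?|?] := leP b L; rewrite ler_norml;
    have [?|?] := ger0P (a - b); apply/andP; split; lra.
apply: le_trans (minL x y); rewrite /clamp.
move: (Num.min x L) (Num.min y L) => a b.
by have [?|?] := leP 0 a; have [?|?] := leP 0 b; rewrite ler_norml;
  have [?|?] := ger0P (a - b); apply/andP; split; lra.
Qed.

(** The arc from the class of [c] up to that of [s], parametrized by the level. Clamping makes [g]
    constant beyond the ends, hence Lipschitz, and so Borel, on the whole line. *)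
Definition geodesic_up c s (g : R -> tree w) := forall y : R,
  [/\ anc w c (repr (g y)), tanc (g y) s & lev (g y) = w c + clamp (w s - w c) y].

Lemma geodesic_up_exists c s : anc w c s -> exists g, geodesic_up c s g.
Proof.
move=> cs; have cs' := anc_le cs.
suff /choice[g gP] : forall y : R, exists tau, [/\ anc w c (repr tau), tanc tau s &
    lev tau = w c + clamp (w s - w c) y] by exists g.
move=> y; have /andP[h1 h2] := @clamp_itv (w s - w c) y (etrans (subr_ge0 _ _) cs').
have [|u [ua us cu]] := @anc_level _ w c s (w c + clamp (w s - w c) y) cs.
  by rewrite lerDl h1/= -lerBrDl.
exists (proj u); split; [|exact/tanc_proj|by rewrite lev_proj].
by have /proj_ancP[_] := repr_proj u; exact: anc_trans.
Qed.

Section geodesic.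
Variables (c s : I) (g : R -> tree w).
Hypotheses (cs : anc w c s) (gP : geodesic_up c s g).

Lemma geodesic_up_dist (x y : R) :
  mdist (g x) (g y) = `|clamp (w s - w c) x - clamp (w s - w c) y|.
Proof.
have [_ xs lx] := gP x; have [_ ys ly] := gP y.
by rewrite (tanc_dist xs ys) lx ly; congr `|_|; ring.
Qed.

Lemma geodesic_up_lev tau : anc w c (repr tau) -> tanc tau s -> g (lev tau - w c) = tau.
Proof.
move=> /anc_le ct ts; have [_ gs gl] := gP (lev tau - w c).
apply: (tanc_level_inj gs ts); rewrite gl clamp_id; first by rewrite subrKC.
by rewrite subr_ge0 ct lerB// (anc_le ts).
Qed.

(** On a geodesic the distances from a point to the two ends add up to [w s - w c], while each is at
    least the corresponding difference of levels. Both are then equalities, which are the two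
    ancestor relations. Conversely, [g] is a geodesic. *)
Lemma tree_arc_up tau :
  tree_arc (proj c) (proj s) tau <-> anc w c (repr tau) /\ tanc tau s.
Proof.
have dcs : mdist (proj c) (proj s) = w s - w c.
  by rewrite mdist_tree_proj; exact/delta_ancP.
have L0 : 0 <= w s - w c by rewrite subr_ge0 anc_le.
split=> [[h []]|[ct ts]].
  rewrite dcs => h0 hL hd [x xL <-].
  have x0L : 0 \in `[0, w s - w c] by rewrite in_itv/= lexx.
  have LL : w s - w c \in `[0, w s - w c] by rewrite in_itv/= lexx L0.
  have d1 := hd _ _ x0L xL; have d2 := hd _ _ xL LL.
  move: xL; rewrite in_itv/= => /andP[x0 xL'].
  move: d1 d2; rewrite h0 hL sub0r normrN ger0_norm// distrC ger0_norm ?subr_ge0//.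
  have [v ->] := proj_surj (h x).
  rewrite !mdist_tree_proj => d1 d2; rewrite tanc_proj.
  have h1 := delta_ge w c v; have h2 := delta_ge w v s.
  have cv : anc w c v by apply/delta_ancP; move: d1 d2 h1 h2; clear; lra.
  split; last by apply/delta_ancP; move: d1 d2 h1 h2; clear; lra.
  by have /proj_ancP[_] := repr_proj v; exact: anc_trans.
exists g; rewrite dcs; split.
- have [_ gs gl] := gP 0; apply: (tanc_level_inj gs); first exact/tanc_proj.
  by rewrite gl lev_proj clamp_id ?addr0// lexx.
- have [_ gs gl] := gP (w s - w c); apply: (tanc_level_inj gs); first exact/tanc_proj/anc_refl.
  by rewrite gl lev_proj clamp_id ?lexx ?L0// subrKC.
- by move=> x y xL yL; rewrite geodesic_up_dist !clamp_id//; rewrite in_itv in xL yL.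
- exists (lev tau - w c); last exact: geodesic_up_lev.
  by rewrite in_itv/= subr_ge0 lerB ?(anc_le ts)// andbT (anc_le ct).
Qed.

End geodesic.

Lemma tree_arcE c s tau : anc w c s ->
  tree_arc (proj c) (proj s) tau <-> anc w c (repr tau) /\ tanc tau s.
Proof. by move=> cs; have [g gP] := geodesic_up_exists cs; exact: tree_arc_up. Qed.

End tree_geometry.

(** * Borel sets and functions on the tree *)

Section tree_borel.
Context {R : realType} (w : continuousType (unit_itv R) R).
Local Notation I := (unit_itv R).
Local Notation proj := (tree_proj w).
Local Notation T := (borel_tree w).
Implicit Types (s t u v c : I) (tau : tree w).

Lemma lipschitz_measurable (F : tree w -> R) (K : R) :
  (forall x y, `|F x - F y| <= K * mdist x y) -> measurable_fun [set: T] (F : T -> R).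
Proof.
move=> FK; apply: (measurability _ (measurable_realfun.RGenOInfty.measurableE R)) => //.
move=> _ [_ [a ->] <-]; rewrite setTI; apply: sub_sigma_algebra.
rewrite openE => x /=; rewrite in_itv/= andbT => ax; apply/nbhs_ballP.
have K0 : 0 < `|K| + 1 by rewrite ltr_wpDl.
exists ((F x - a) / (`|K| + 1)); first by rewrite /= divr_gt0// subr_gt0.
move=> y; rewrite ballEmdist /= in_itv/= andbT ltr_pdivlMr// => d.
have := FK x y; rewrite ler_norml => /andP[_ h2].
have : K * mdist x y <= mdist x y * (`|K| + 1).
  by rewrite mulrC ler_wpM2l ?mdist_ge0// (le_trans (ler_norm _))// lerDl.
by move: h2 d; clear; lra.
Qed.

Lemma measurable_lev : measurable_fun [set: T] (@lev R w : T -> R).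
Proof. by apply: (@lipschitz_measurable _ 1) => x y; rewrite mul1r lev_dist. Qed.

Lemma measurable_mdist (x : tree w) : measurable_fun [set: T] (mdist x : T -> R).
Proof.
apply: (@lipschitz_measurable _ 1) => y z; rewrite mul1r ler_norml.
have h1 := metric_triangle x y z; have h2 := metric_triangle x z y.
by rewrite (metric_sym z) in h2; apply/andP; split; move: h1 h2; clear; lra.
Qed.

Lemma measurable_tree_point (x : tree w) : measurable ([set x] : set T).
Proof.
rewrite (_ : [set x] = mdist x @^-1` [set 0]).
  by rewrite -[X in measurable X]setTI; apply: measurable_mdist.
apply/seteqP; split=> y /= => [->|/mdist_positivity//]; exact: mdistxx.
Qed.

(** The arc is the set where the sum of the distances to the two ends equals the distance between
    them, a level set of a continuous function. *)
Lemma measurable_tree_arc c s : anc w c s -> measurable (tree_arc (proj c) (proj s) : set T).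
Proof.
move=> cs; rewrite (_ : tree_arc _ _ =
    (fun x => mdist (proj c) x + mdist (proj s) x) @^-1` [set w s - w c]).
  rewrite -[X in measurable X]setTI.
  by apply: (measurable_funD (measurable_mdist _) (measurable_mdist _)).
apply/seteqP; split => x; have [v ->] := proj_surj x;
    rewrite /= (tree_arcE _ cs) tanc_proj !mdist_tree_proj.
  move=> [cv vs]; rewrite (deltaC w s).
  have /delta_ancP -> : anc w c v.
    by have /proj_ancP[+ _] := repr_proj w v; exact: anc_trans.
  by move/delta_ancP : vs => ->; ring.
rewrite (deltaC w s) => E; have h1 := delta_ge w c v; have h2 := delta_ge w v s.
have cv : anc w c v by apply/delta_ancP; move: E h1 h2; clear; lra.
split; last by apply/delta_ancP; move: E h1 h2; clear; lra.
by have /proj_ancP[_] := repr_proj w v; exact: anc_trans.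
Qed.

Lemma measurable_geodesic_up c s (g : R -> tree w) : geodesic_up c s g ->
  measurable_fun [set: R] (g : R -> T).
Proof.
move=> gP; apply: (@measurability _ _ _ T _ _ (@open (tree w))) => //.
move=> _ [A oA <-]; rewrite setTI; apply: open_measurable.
rewrite openE => x /= Ax; apply/nbhs_ballP.
move: oA; rewrite openE => /(_ _ Ax) /nbhs_ballP[e /= e0 he].
exists e => // y xy; apply: he; rewrite ballEmdist/= (geodesic_up_dist gP).
exact: le_lt_trans (clamp_lip _ _ _) xy.
Qed.

Variable lambda : {measure set T -> \bar R}.
Hypothesis arc_length : forall a b : tree w, lambda (tree_arc a b) = (mdist a b)%:E.

(** A point is an arc of length zero. *)
Lemma lambda_point (x : tree w) : lambda [set x] = 0%E.
Proof.
have [v ->] := proj_surj x; have := arc_length (proj v) (proj v).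
rewrite mdistxx (_ : tree_arc _ _ = [set proj v])//.
apply/seteqP; split=> y; rewrite tree_arcE; try exact: anc_refl.
  by move=> [h1 h2]; rewrite /= -[y]reprK; apply/esym/proj_ancP.
by move=> ->; have /proj_ancP[] := repr_proj w v.
Qed.

End tree_borel.

Lemma pushforward_measureE d d' (T : measurableType d) (Y : measurableType d')
    (R : realType) (mu : {measure set T -> \bar R}) (phi : T -> Y) :
  measurable_fun setT phi ->
  exists kap : {measure set Y -> \bar R}, forall A, kap A = mu (phi @^-1` A).
Proof.
move=> mphi.
pose kap : {measure set Y -> \bar R} := HB.pack (pushforward mu phi).
by exists (kap mphi).
Qed.

(* The second summand completes the first one to a measure on the whole line, to
   which the uniqueness of the Lebesgue measure applies. *)
Lemma lebesgue_measure_itv_unique (R : realType) (L : R)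
    (kap : {measure set (measurableTypeR R) -> \bar R}) :
  (forall X, ocitv X -> lebesgue_measure (X `&` `[0, L]) = kap (X `&` `[0, L])) ->
  forall A, measurable A -> A `<=` `[0, L] -> lebesgue_measure A = kap A.
Proof.
move=> kE A mA AL.
pose D : set (measurableTypeR R) := `[0, L]%classic.
have mD : measurable D by exact: measurable_itv.
have mDC : measurable (~` D) by exact: measurableC.
pose mu := measure_add (mrestr kap mD) (mrestr (@lebesgue_measure R) mDC).
have muE B : mu B = (kap (B `&` D) + lebesgue_measure (B `\` D))%E.
  by rewrite /mu measure_addE.
have -> : lebesgue_measure A = mu A.
  apply: lebesgue_measure_unique => // X oX; rewrite [RHS]muE -kE// addeC.
  by apply: measureDI => //; exact: sub_sigma_algebra.
by rewrite muE (setIidl AL) (_ : A `\` D = set0) ?measure0 ?adde0// setD_eq0.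
Qed.

(** * The length measure on an arc *)

Section arc_measure.
Context {R : realType} (w : continuousType (unit_itv R) R).
Local Notation I := (unit_itv R).
Local Notation proj := (tree_proj w).
Local Notation T := (borel_tree w).
Variable lambda : {measure set T -> \bar R}.
Hypothesis arc_length : forall a b : tree w, lambda (tree_arc a b) = (mdist a b)%:E.
Variables (c s : I) (g : R -> tree w).
Hypotheses (cs : anc w c s) (gP : geodesic_up c s g).
Let L := w s - w c.
Let arc : set T := tree_arc (proj c) (proj s).

Let L0 : 0 <= L. Proof. by rewrite subr_ge0 anc_le. Qed.

Lemma arc_lev tau : arc tau -> 0 <= lev tau - w c <= L.
Proof.
by move=> /(tree_arcE _ cs)[/anc_le h1 /anc_le h2]; rewrite subr_ge0 h1 lerB.
Qed.

(** The part of an arc between two levels is again an arc, with ends [g a] and [g b], so its measure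
    is known. *)
Lemma arc_slice_cc (a b : R) : 0 <= a -> a <= b -> b <= L ->
  lambda [set tau | arc tau /\ a <= lev tau - w c <= b] = (b - a)%:E.
Proof.
move=> a0 ab bL.
have clampE y : 0 <= y -> y <= L -> clamp L y = y.
  by move=> y0 yL; apply: clamp_id; rewrite y0.
have [ca as_ la] := gP a; have [cb bs lb] := gP b.
move: la lb; rewrite !clampE//; [move=> la lb|lra|lra].
set u := repr (g a) in ca as_ la *; set v := repr (g b) in cb bs lb *.
have uv : anc w u v by apply: (anc_chain as_ bs); rewrite -/(lev _) -/(lev _) la lb lerD2l.
rewrite [X in lambda X](_ : _ = tree_arc (proj u) (proj v)).
  rewrite arc_length mdist_tree_proj; move/delta_ancP : uv => ->.
  by rewrite -/(lev (g a)) -/(lev (g b)) la lb; congr (_%:E); ring.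
apply/seteqP; split => tau; rewrite /= (tree_arcE _ uv) /arc (tree_arcE _ cs).
  move=> [[ct ts] /andP[h1 h2]]; split.
    by apply: (anc_chain as_ ts); rewrite -/(lev _) -/(lev _) la; lra.
  by apply: (anc_chain ts bs); rewrite -/(lev _) -/(lev _) lb; lra.
move=> [ut tv]; split; first by split; [exact: anc_trans ca ut|exact: anc_trans tv bs].
have := anc_le ut; have := anc_le tv.
by rewrite -/(lev (g a)) -/(lev (g b)) -/(lev tau) la lb => h1 h2; apply/andP; split; lra.
Qed.

Lemma arc_slice_oc (a b : R) : 0 <= a -> a <= b -> b <= L ->
  lambda [set tau | arc tau /\ a < lev tau - w c <= b] = (b - a)%:E.
Proof.
move=> a0 ab bL; rewrite -(arc_slice_cc a0 ab bL).
have mlevb (x y : R) : measurable [set tau : T | arc tau /\ x < lev tau - w c <= y].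
  rewrite (_ : [set _ | _] = arc `&` (@lev _ w : T -> R) @^-1` `]x + w c, y + w c]).
    apply: measurableI; first exact: measurable_tree_arc.
    rewrite -[X in measurable X]setTI.
    exact: (measurable_lev measurableT (measurable_itv _)).
  by apply/seteqP; split=> t /= [ha]; rewrite in_itv/= ltrBrDr lerBlDr.
have [_ _ la] := gP a.
rewrite [RHS](_ : _ = lambda ([set tau | arc tau /\ a < lev tau - w c <= b] `|` [set g a])).
  by rewrite measureU0//; [exact: measurable_tree_point|exact: lambda_point].
congr (lambda _); apply/seteqP; split => tau /=.
  move=> [at_ /andP[]]; rewrite le_eqVlt => /orP[/eqP e _|-> ->]; last by left.
  right; have [ct ts] := (tree_arcE _ cs).1 at_.
  by rewrite -(geodesic_up_lev gP ct ts) e.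
move=> [[at_ /andP[/ltW -> ->]]//|->].
have [ca as_ _] := gP a; split; first exact/(tree_arcE _ cs).
rewrite la.
have -> : clamp (w s - w c) a = a by apply: clamp_id; rewrite a0 (le_trans ab).
by apply/andP; split; lra.
Qed.

(** The height above [c] is inverse to [g] on the arc. It carries the length measure to Lebesgue
    measure, because the two agree on intervals, whose preimages are slices of the arc. *)
Lemma arc_pushforward (f : T -> \bar R) : measurable_fun setT f ->
  (forall tau, 0 <= f tau)%E ->
  (\int[lambda]_(tau in arc) f tau =
   \int[@lebesgue_measure R]_(y in `[0%R, L]) f (g y))%E.
Proof.
move=> mf f0.
have marc : measurable arc by exact: measurable_tree_arc.
(* The value [-1] off the arc makes the preimage of [[0, L]] exactly the arc. *)
pose phi (tau : T) : R := (lev tau - w c) * \1_arc tau - \1_(~` arc) tau.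
have phi_arc tau : arc tau -> phi tau = lev tau - w c.
  by move=> at_; rewrite /phi !indicE mem_set// memNset ?mulr1 ?subr0//; apply.
have phi_out tau : ~ arc tau -> phi tau = -1.
  by move=> at_; rewrite /phi !indicE memNset// mem_set// mulr0 sub0r.
have mphi : measurable_fun setT phi.
  apply: measurable_funB; last by apply: measurable_indic; exact: measurableC.
  apply: measurable_funM; last exact: measurable_indic.
  by apply: measurable_funB => //; exact: measurable_lev.
have preim : phi @^-1` `[0, L] = arc.
  apply/seteqP; split=> tau /=; rewrite in_itv/=; last first.
    by move=> at_; rewrite phi_arc// arc_lev.
  by move=> h; apply: contrapT => /phi_out e; move: h; rewrite e; lra.
have [kap kapE] := pushforward_measureE lambda
  (mphi : measurable_fun setT (phi : T -> measurableTypeR R)).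
have kapL : forall A : set (measurableTypeR R), measurable A ->
    A `<=` `[0, L] -> lebesgue_measure A = kap A.
  apply: lebesgue_measure_itv_unique => _ [[a b] _ <-] /=; rewrite kapE preimage_setI preim.
  (* For [a < 0] the trace of []a, b]] on [[0, L]] is closed at [0]; otherwise it is half-open. Each
     case has its own slice lemma. *)
  have [a0|a0] := ltP a 0.
    rewrite (_ : `]a, b] `&` `[0, L] = `[0, Num.min b L]%classic); last first.
      apply/seteqP; split=> y /=; rewrite !in_itv/= le_min.
        by move=> [/andP[_ ->] /andP[-> ->]].
      by move=> /and3P[y0 -> ->]; rewrite y0 (lt_le_trans a0).
    rewrite lebesgue_measure_itv/= lte_fin.
    rewrite (_ : _ `&` arc =
        [set tau | arc tau /\ 0 <= lev tau - w c <= Num.min b L]); last first.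
      apply/seteqP; split=> tau /=; rewrite in_itv/= le_min.
        move=> [/[swap] at_]; rewrite phi_arc// => /andP[_ ->].
        by have /andP[-> ->] := arc_lev at_.
      move=> [at_ /and3P[h1 h2 _]]; rewrite phi_arc// h2 andbT.
      by rewrite (lt_le_trans a0).
    have [b0|b0] := leP 0 (Num.min b L).
      rewrite arc_slice_cc// ?ge_min ?lexx ?orbT// subr0.
      move: b0; rewrite le_eqVlt => /orP[/eqP <-|->]; last by rewrite -EFinB subr0.
      by rewrite ltxx.
    rewrite ltNge (ltW b0)/= [X in lambda X](_ : _ = set0) ?measure0//.
    by rewrite -subset0 => tau [_ /andP[h1 h2]]; move: h1 h2 b0; lra.
  rewrite (_ : `]a, b] `&` `[0, L] = `]a, Num.min b L]%classic); last first.
    apply/seteqP; split=> y /=; rewrite !in_itv/= le_min.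
      by move=> [/andP[-> ->] /andP[_ ->]].
    by move=> /and3P[ay -> ->]; rewrite ay (ltW (le_lt_trans a0 ay)).
  rewrite lebesgue_measure_itv/= lte_fin.
  rewrite (_ : _ `&` arc =
      [set tau | arc tau /\ a < lev tau - w c <= Num.min b L]); last first.
    apply/seteqP; split=> tau /=; rewrite in_itv/= le_min.
      move=> [/[swap] at_]; rewrite phi_arc// => /andP[-> ->].
      by have /andP[_ ->] := arc_lev at_.
    by move=> [at_ /and3P[h1 h2 _]]; rewrite phi_arc// h2 h1.
  have [ab|ab] := ltP a (Num.min b L).
    by rewrite arc_slice_oc ?(ltW ab)// ?ge_min ?lexx ?orbT.
  rewrite [X in lambda X](_ : _ = set0) ?measure0//.
  by rewrite -subset0 => tau [_ /andP[h1 h2]]; move: h1 h2 ab; lra.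
have mfg : measurable_fun [set: R] (f \o g).
  by apply: measurableT_comp => //; exact: measurable_geodesic_up gP.
pose phi' : T -> measurableTypeR R := phi.
pose D : set (measurableTypeR R) := `[0, L]%classic.
transitivity (\int[kap]_(y in D) f (g y))%E; last first.
  by apply: eq_measure_integral => A mA AL; exact: esym (kapL A mA AL).
transitivity (\int[pushforward lambda phi']_(y in D) f (g y))%E; last first.
  by apply: eq_measure_integral => A mA AL; exact: esym (kapE A).
rewrite (@ge0_integral_pushforward _ _ _ _ _ phi')//; first last.
- by apply: measurable_funS mfg.
- exact: measurable_itv.
rewrite preim; apply: eq_integral => tau /set_mem at_ /=.
by rewrite /phi' phi_arc//; have [ct ts] := (tree_arcE _ cs).1 at_; rewrite (geodesic_up_lev gP).
Qed.

End arc_measure.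

(** * The skeleton *)

Section leaves_null.
Context {R : realType} (w : continuousType (unit_itv R) R).
Local Notation I := (unit_itv R).
Local Notation proj := (tree_proj w).
Local Notation T := (borel_tree w).
Implicit Types (s t u v c : I) (tau : tree w).

Definition rational_time (n : nat) : I :=
  if unpickle n is Some q then insubd (time0 R) (ratr q) else time0 R.

Lemma rational_time_dense t (d : R) : 0 < d ->
  exists n, `|time (rational_time n) - time t| < d.
Proof.
move=> d0; have t0 := time_ge0 t; have t1 := time_le1 t.
have /rat_in_itvoo[q] : Num.max 0 (time t - d) < Num.min 1 (time t + d).
  by rewrite gt_max !lt_min; apply/andP; split; apply/andP; split; lra.
rewrite in_itv/= gt_max lt_min => /andP[/andP[q0 tq] /andP[q1 qt]].
exists (pickle q); rewrite /rational_time pickleK.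
have -> : time (insubd (time0 R) (ratr q)) = ratr q.
  by rewrite /time val_insubd mem_unit_itv// (ltW q0) (ltW q1).
by rewrite ltr_norml; apply/andP; split; lra.
Qed.

(** The subtree above [tau] has height greater than [e]. In particular [higher 0] is the skeleton,
    the complement of the leaves. *)
Definition higher (e : R) tau := exists2 u, tanc tau u & lev tau + e < w u.

(** By continuity the path stays above [lev tau + e] from [u] to a nearby rational time, so it does
    not leave the subtree on the way. This reduces [higher e] to a countable union. *)
Lemma higher_rational (e : R) tau : 0 <= e -> higher e tau ->
  exists2 n, tanc tau (rational_time n) & lev tau + e < w (rational_time n).
Proof.
move=> e0 [u tu hu]; have [|d d0 hd] := @path_continuous _ w u (w u - (lev tau + e)).
  by rewrite subr_gt0.
have [n nd] := rational_time_dense u d0.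
have hn v : between u (rational_time n) v -> lev tau + e < w v.
  move=> /betweenP unv; have : `|time v - time u| < d.
    by apply: le_lt_trans nd; rewrite ler_norml;
      have [?|?] := ger0P (time (rational_time n) - time u);
      case: unv => /andP[? ?]; apply/andP; split; lra.
  by move=> /hd; rewrite ltr_norml => /andP[+ _]; lra.
exists n; last by apply: hn; rewrite betweenC; exact: between_refl.
move=> v /(between_split u)[/tu//|/hn h].
by rewrite -/(lev _); lra.
Qed.

Variables (U : I) (lambda : {measure set T -> \bar R}).
Hypothesis minU : is_min_time w U.

Lemma root_anc s : anc w U s. Proof. by move=> u _; exact: minU. Qed.

Lemma arc_rootE s tau : tree_arc (proj U) (proj s) tau <-> tanc tau s.
Proof.
rewrite (tree_arcE _ (@root_anc s)); split => [[]//|]; split => //; exact: root_anc.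
Qed.

(** A descendant of [tau] at the level of [tau] is [tau] itself; so a point distinct from [tau] and
    above it has a strictly greater level. *)
Lemma leavesE : leaves (proj U) = ~` higher 0.
Proof.
apply/seteqP; split => tau.
  move=> ltau [u tu]; rewrite addr0 => hu; apply: (ltau (proj u)); last exact/arc_rootE.
  by move=> e; move: hu; rewrite -e lev_proj ltxx.
move=> nh b btau; have [s bE] := proj_surj b; rewrite bE in btau *.
move=> /arc_rootE ts; apply: btau; have := anc_le ts; rewrite le_eqVlt => /orP[/eqP e|h].
  by apply: (@tanc_level_inj _ _ _ _ s _ ts); [exact/tanc_proj/anc_refl|rewrite lev_proj].
by exfalso; apply: nh; exists s => //; rewrite addr0.
Qed.

Lemma measurable_higher (e : R) : 0 <= e -> measurable (higher e : set T).
Proof.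
move=> e0; rewrite (_ : higher e = \bigcup_n (tree_arc (proj U) (proj (rational_time n)) `&`
    (@lev _ w : T -> R) @^-1` `]-oo, w (rational_time n) - e[)).
  apply: bigcupT_measurable => n; apply: measurableI.
    by apply: measurable_tree_arc; exact: root_anc.
  rewrite -[X in measurable X]setTI.
  exact: (measurable_lev measurableT (measurable_itv _)).
apply/seteqP; split => tau.
  move=> /(higher_rational e0)[n tn hn]; exists n => //; split; first exact/arc_rootE.
  by rewrite /= in_itv/= ltrBrDr.
move=> [n _ [/arc_rootE tn]]; rewrite /= in_itv/= ltrBrDr => hn.
by exists (rational_time n).
Qed.

Hypothesis lambda_length : is_length_measure (proj U) lambda.

Lemma lambda_leaves : lambda (~` higher 0) = 0%E.
Proof. by rewrite -leavesE; exact: lambda_length.1. Qed.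

Lemma integral_higher (f : T -> \bar R) : measurable_fun setT f ->
  (forall tau, 0 <= f tau)%E ->
  (\int[lambda]_tau f tau = \int[lambda]_(tau in higher 0) f tau)%E.
Proof.
move=> mf f0; have mh := measurable_higher (lexx 0).
rewrite (@ge0_negligible_integral _ T _ lambda _ (~` higher 0))//.
- by rewrite setTD setCK.
- exact: measurableC.
- exact: lambda_leaves.
Qed.

(** The arcs from the root to the rational times cover the skeleton; each is cut at the levels
    [w U + k * eta]. Levels are capped at the top of the arc, so the pieces beyond the top
    degenerate to a point: this is the alternative [w (c i) = w (s i)]. *)
Lemma skeleton_cover (eta : R) : 0 < eta ->
  exists (c s : nat -> I) (g : nat -> R -> tree w),
    (forall i, [/\ anc w (c i) (s i), geodesic_up (c i) (s i) (g i),
       w (s i) - w (c i) <= eta &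
       w (c i) = w (s i) \/ exists k : nat, w (c i) = w U + k%:R * eta]) /\
    higher 0 `<=` \bigcup_i tree_arc (proj (c i)) (proj (s i)).
Proof.
move=> eta0.
have key (i : nat * nat) : exists p : I * I * (R -> tree w),
    [/\ anc w p.1.1 p.1.2, geodesic_up p.1.1 p.1.2 p.2,
        anc w p.1.2 (rational_time i.1),
        w p.1.1 = Num.min (w U + i.2%:R * eta) (w (rational_time i.1)) &
        w p.1.2 = Num.min (w U + i.2.+1%:R * eta) (w (rational_time i.1))].
  have h (k : nat) : w U <= Num.min (w U + k%:R * eta) (w (rational_time i.1)) <=
      w (rational_time i.1).
    by rewrite le_min minU lerDl mulr_ge0 ?ler0n ?(ltW eta0)//= ge_min lexx orbT.
  have [s [ws srn _]] := anc_level (@root_anc _) (h i.2.+1).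
  have [|c [wc cs _]] := @anc_level _ w U s
    (Num.min (w U + i.2%:R * eta) (w (rational_time i.1))) (@root_anc _).
    have /andP[-> _] := h i.2; rewrite ws le_min ge_min ge_min lexx orbT andbT/=.
    by apply/orP; left; rewrite lerD2l ler_pM2r// ler_nat.
  have [g gP] := geodesic_up_exists cs.
  by exists (c, s, g).
have [p pP] := choice key.
have [g0 g0P] := geodesic_up_exists (@root_anc U).
(* Integers that encode no pair are given the trivial arc at the root. *)
pose P (i : nat) := if unpickle i is Some j then p j else (U, U, g0).
exists (fun i => (P i).1.1), (fun i => (P i).1.2), (fun i => (P i).2); split.
  move=> i; rewrite /P; case: unpickle => [j|]; last first.
    by split => //=; [rewrite subrr ltW|left].
  have [cs gP _ wc ws] := pP j; split => //.
    rewrite wc ws -natr1 mulrDl mul1r addrA.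
    move: (w U + j.2%:R * eta) (w (rational_time j.1)) => a b.
    by have [?|?] := leP a b; have [?|?] := leP (a + eta) b; lra.
  rewrite wc ws; have [h|h] := leP (w U + j.2%:R * eta) (w (rational_time j.1)).
    by right; exists j.2.
  left; apply/esym/min_idPr; apply: le_trans (ltW h) _.
  by rewrite lerD2l ler_pM2r// ler_nat.
move=> tau /(higher_rational (lexx 0))[n tn hn]; rewrite addr0 in hn.
have x0 : 0 <= (lev tau - w U) / eta by rewrite divr_ge0 ?subr_ge0 ?(ltW eta0)//; exact: minU.
have := truncn_itv x0; set k := Num.truncn _ => /andP[k1 k2].
rewrite ler_pdivlMr// in k1; rewrite ltr_pdivrMr// in k2.
exists (pickle (n, k)) => //; rewrite /P pickleK.
have [cs gP sn wc ws] := pP (n, k); apply/tree_arcE => //; split.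
  apply: (anc_chain (anc_trans cs sn) tn); rewrite wc/= -/(lev _) ge_min.
  by apply/orP; left; lra.
by apply: (anc_chain tn sn); rewrite ws/= -/(lev _) le_min (ltW hn) andbT; lra.
Qed.

(** A coarea argument. Each piece of the cover is parametrized by the height [y] in []0, eta[] above
    its base. After exchanging sum and integral, the points at a given [y] have levels congruent
    modulo [eta], so their sum is at most [K], and [y] ranges over a length [eta]. *)
Lemma level_bound (eta K : R) (f : T -> \bar R) :
  0 < eta -> 0 <= K -> measurable_fun setT f -> (forall tau, 0 <= f tau)%E ->
  (forall l : seq (tree w), uniq l -> (forall x, x \in l -> higher 0 x) ->
    (forall x y, x \in l -> y \in l -> exists k : int, lev x - lev y = k%:~R * eta) ->
    (\sum_(x <- l) f x <= K%:E)%E) ->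
  (\int[lambda]_tau f tau <= (eta * K)%:E)%E.
Proof.
move=> eta0 K0 mf f0 fK; rewrite integral_higher//.
have [c [s [g [csg cover]]]] := skeleton_cover eta0.
have cs i : anc w (c i) (s i) by have [] := csg i.
have gP i : geodesic_up (c i) (s i) (g i) by have [] := csg i.
pose A i : set T := tree_arc (proj (c i)) (proj (s i)).
have mA i : measurable (A i) by exact: measurable_tree_arc.
(* Disjoint pieces ensure that, for a given [y], the points coming from different indices are
   distinct. *)
pose E := seqDU A.
have mE i : measurable (E i) by exact: seqDU_measurable.
have mfE i : measurable_fun setT (f \_ (E i)).
  by apply/(measurable_restrictT _ (mE i)); exact: measurable_funS mf.
have fE0 i tau : (0 <= (f \_ (E i)) tau)%E by rewrite erestrict_ge0.
pose L i := w (s i) - w (c i).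
pose D : set R := `]0, eta[%classic.
have mD : measurable D by exact: measurable_itv.
pose h i (y : R) := (((f \_ (E i)) \o g i) \_ `]0, L i[) y.
have mg i : measurable_fun [set: R] (g i : R -> T) by exact: measurable_geodesic_up (gP i).
have mfg i : measurable_fun [set: R] ((f \_ (E i)) \o g i).
  by exact: (measurableT_comp (mfE i) (mg i)).
have mh i : measurable_fun D (h i).
  apply: (@measurable_funS _ _ _ _ setT) => //.
  have mI : measurable (`]0, L i[%classic : set R) by exact: measurable_itv.
  by apply/(measurable_restrictT _ mI); exact: measurable_funS (mfg i).
have h0 i y : (0 <= h i y)%E by rewrite erestrict_ge0// => z _; exact: fE0.
have fh i : (\int[lambda]_(tau in E i) f tau = \int[@lebesgue_measure R]_(y in D) h i y)%E.
  transitivity (\int[lambda]_(tau in A i) (f \_ (E i)) tau)%E.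
    rewrite -integral_mkcondr setIidr//; exact: subset_seqDU.
  rewrite (arc_pushforward lambda_length.2 (cs i) (gP i))//.
  (* Without the ends, [y < L i] puts [g i y] strictly below [s i], hence on the skeleton, and
     [0 < y < L i] excludes the degenerate pieces. *)
  rewrite integral_itv_bndoo; last by apply: measurable_funS (mfg i).
  rewrite [RHS](_ : _ = \int[@lebesgue_measure R]_(y in D `&` `]0%R, L i[)
      ((f \_ (E i)) \o g i) y)%E; last by rewrite integral_mkcondr.
  congr integral.
  rewrite setIidr// => y; rewrite /D /= !in_itv/= => /andP[-> yL].
  by apply: lt_le_trans yL _; have [] := csg i.
have mbig : measurable (\bigcup_i A i) by exact: bigcupT_measurable.
apply: (@le_trans _ _ (\int[lambda]_(tau in \bigcup_i A i) f tau)%E).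
  apply: ge0_subset_integral => //; first exact: measurable_higher.
  exact: measurable_funS mf.
rewrite seqDU_bigcup_eq -/E ge0_integral_bigcup//; first last.
- exact: trivIset_seqDU.
- exact: measurable_funS mf.
under eq_eseriesr do rewrite fh.
rewrite -integral_nneseries//.
have -> : (eta * K)%:E = (\int[@lebesgue_measure R]_(y in D) (cst K%:E y))%E.
  have muD : lebesgue_measure D = eta%:E.
    by rewrite lebesgue_measure_itv/= lte_fin eta0 -EFinB subr0.
  transitivity (K%:E * eta%:E)%E; first by rewrite -EFinM mulrC.
  by rewrite integral_cst// -muD.
apply: ge0_le_integral => //.
- by move=> y _; apply: nneseries_ge0 => n _ _; exact: h0.
- by apply: (@ge0_emeasurable_sum _ _ _ D h xpredT) => // i y Dy _; exact: h0.
move=> y Dy; rewrite /cst.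
apply: lime_le; first by apply: is_cvg_nneseries => n _ _; exact: h0.
apply: nearW => N.
pose ok i := (y \in (`]0, L i[%classic : set R)) && (g i y \in E i).
have hE i : h i y = if ok i then f (g i y) else 0%E.
  by rewrite /h /ok /patch; case: ifP => //=; rewrite /patch; case: ifP.
pose l := [seq g i y | i <- index_iota 0 N & ok i].
have okP i : ok i -> [/\ 0 < y < L i, tanc (g i y) (s i), E i (g i y) & lev (g i y) = w (c i) + y].
  move=> /andP[/set_mem]; rewrite /= in_itv/= => /andP[y0 yL] /set_mem Ei.
  have [_ gs gl] := gP i y; split => //; first by rewrite y0.
  by rewrite gl clamp_id// (ltW y0) (ltW yL).
rewrite (_ : (\sum_(0 <= i < N) h i y = \sum_(x <- l) f x)%E); last first.
  rewrite /l big_map big_filter [in RHS]big_mkcond/=.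
  by apply: eq_bigr => i _; rewrite hE.
apply: fK.
- rewrite map_inj_in_uniq; first by rewrite filter_uniq// iota_uniq.
  move=> i j; rewrite !mem_filter => /andP[/okP[_ _ Ei _] _] /andP[/okP[_ _ Ej _] _] e.
  apply: (@trivIset_seqDU _ A i j) => //; exists (g i y); split => //.
  by rewrite e.
- move=> x /mapP[i]; rewrite mem_filter => /andP[/okP[/andP[y0 yL] gs _ gl] _] ->.
  by exists (s i) => //; rewrite gl addr0 -ltrBrDl.
- have lvl i : ok i -> exists k : nat, lev (g i y) = w U + k%:R * eta + y.
    move=> /okP[/andP[y0 yL] _ _ ->]; have [_ _ _ []] := csg i; last by move=> [k ->]; exists k.
    by move=> e; move: y0 yL; rewrite /L e subrr; lra.
  move=> x x' /mapP[i]; rewrite mem_filter => /andP[/lvl[k gi] _] ->.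
  move=> /mapP[j]; rewrite mem_filter => /andP[/lvl[k' gj] _] ->.
  exists (k%:Z - k'%:Z); rewrite gi gj intrB.
  by ring.
Qed.

End leaves_null.

(** * Variations as sums over chains of intervals *)

Section chains.
Context {R : realType}.
Local Notation I := (unit_itv R).
Implicit Types (s t u v x y : I) (l : seq (I * I)) (P : I -> I -> Prop) (f : I -> R).

(** Successive intervals inside [[s, t]], with gaps allowed: families on adjacent intervals can be
    concatenated, without the parity of indices in [Vcond]. *)
Fixpoint chain s t l : bool :=
  if l is p :: l' then
    [&& time s <= time p.1, time p.1 <= time p.2, time p.2 <= time t & chain p.2 t l']
  else true.

Definition linked P l := forall p, p \in l -> P p.1 p.2.

Definition chain_sum (q : R) f l : R := \sum_(p <- l) `|f p.2 - f p.1| `^ q.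

(** Common form of the two variations, localized to [[s, t]]: [P] is trivial for [Vp], and requires
    equal values of [w] for [Vcond]. *)
Definition chain_var P (q : R) f s t : \bar R :=
  ereal_sup [set (chain_sum q f l)%:E | l in [set l | chain s t l /\ linked P l]].

Lemma chainS s s' t t' l : time s' <= time s -> time t <= time t' ->
  chain s t l -> chain s' t' l.
Proof.
elim: l s s' => //= p l ih s s' ss' tt' /and4P[h1 h2 h3 h4].
by rewrite (le_trans ss' h1) h2 (le_trans h3 tt')/=; apply: ih h4.
Qed.

Lemma chain_cat s u t l l' : time s <= time u <= time t ->
  chain s u l -> chain u t l' -> chain s t (l ++ l').
Proof.
move=> /andP[su ut]; elim: l s su => /= [|p l ih] s su; first by move=> _; apply: chainS.
move=> /and4P[h1 h2 h3 h4] h5; rewrite h1 h2 (le_trans h3 ut)/=; exact: ih.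
Qed.

Lemma chain_sum_le P q f s t l : chain s t l -> linked P l ->
  ((chain_sum q f l)%:E <= chain_var P q f s t)%E.
Proof. by move=> cl Pl; apply: ereal_sup_ubound; exists l. Qed.

Lemma chain_var_ge0 P q f s t : (0 <= chain_var P q f s t)%E.
Proof.
have <- : ((chain_sum q f [::])%:E = 0)%E by rewrite /chain_sum big_nil.
by apply: chain_sum_le.
Qed.

Lemma chain_varS P q f s s' t t' : time s' <= time s -> time t <= time t' ->
  (chain_var P q f s t <= chain_var P q f s' t')%E.
Proof.
move=> ss' tt'; apply: ge_ereal_sup => _ [l [cl Pl] <-].
by apply: chain_sum_le => //; exact: chainS cl.
Qed.

Lemma chain_var_split P q f s u t : time s <= time u <= time t ->
  (chain_var P q f s u + chain_var P q f u t <= chain_var P q f s t)%E.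
Proof.
move=> sut; rewrite addeC.
have [->|ne] := eqVneq (chain_var P q f s t) +oo%E; first exact: leey.
have fin x y : (chain_var P q f x y <= chain_var P q f s t)%E ->
    chain_var P q f x y \is a fin_num.
  by move=> h; rewrite ge0_fin_numE ?chain_var_ge0// (le_lt_trans h)// ltey.
have /andP[su ut] := sut.
have fut : chain_var P q f u t \is a fin_num by apply: fin; exact: chain_varS.
rewrite -leeBrDl//; apply: ge_ereal_sup => _ [l [cl Pl] <-].
rewrite leeBrDl// -leeBrDr//; apply: ge_ereal_sup => _ [l' [cl' Pl'] <-].
rewrite leeBrDr// -EFinD addrC.
have -> : chain_sum q f l + chain_sum q f l' = chain_sum q f (l ++ l').
  by rewrite /chain_sum big_cat.
apply: chain_sum_le; first exact: chain_cat cl cl'.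
by move=> p; rewrite mem_cat => /orP[/Pl|/Pl'].
Qed.

Lemma chain_var_superadditive P q f s t l : chain s t l ->
  (\sum_(p <- l) chain_var P q f p.1 p.2 <= chain_var P q f s t)%E.
Proof.
elim: l s => [|p l ih] s /=; first by rewrite big_nil chain_var_ge0.
rewrite big_cons => /and4P[h1 h2 h3 /ih h4].
apply: le_trans (leeD2l _ h4) _.
apply: (le_trans (chain_var_split _ _ _ _)); first by rewrite h2.
exact: chain_varS.
Qed.

(** All the ends in order; padding with the time 1 keeps the sequence nondecreasing. *)
Fixpoint chain_times l (i : nat) : I :=
  if l is p :: l' then
    match i with 0%N => p.1 | 1%N => p.2 | i.+2 => chain_times l' i end
  else time1 R.

Lemma chain_times_ge s l i : chain s (time1 R) l -> time s <= time (chain_times l i).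
Proof.
elim: l s i => [|p l ih] s i /=; first by move=> _; exact: time_le1.
move=> /and4P[h1 h2 h3 h4]; case: i => [//|[|i]]; first exact: le_trans h2.
apply: le_trans (le_trans h1 h2) _; exact: ih.
Qed.

Lemma chain_times_homo s l : chain s (time1 R) l -> forall i j, (i <= j)%N ->
  time (chain_times l i) <= time (chain_times l j).
Proof.
elim: l s => [|p l ih] s //= /and4P[h1 h2 h3 h4].
move=> [|[|i]] [|[|j]]//= ij.
- by apply: le_trans h2 _; exact: chain_times_ge.
- exact: chain_times_ge.
- by apply: (ih _ h4); rewrite !ltnS in ij.
Qed.

Lemma sum_chain_times (F : I -> I -> R) l :
  \sum_(k < size l) F (chain_times l k.*2) (chain_times l k.*2.+1) =
  \sum_(p <- l) F p.1 p.2.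
Proof.
elim: l => [|p l ih]; first by rewrite big_ord0 big_nil.
by rewrite big_ord_recl big_cons -ih /=; congr (_ + _); apply: eq_bigr.
Qed.

(** The time 0 in front shifts the indices by one, because the pairs in [Vcond] start at odd
    indices. *)
Let times l i := if i is i'.+1 then chain_times l i' else time0 R.

Let times_subdivision l : chain (time0 R) (time1 R) l -> subdivision (times l).
Proof.
move=> cl [|i] [|j]// ij; rewrite -!/(time _); first exact: time_ge0.
exact: (chain_times_homo cl (ij : (i <= j)%N)).
Qed.

Lemma chain_iota (a b : nat -> I) s t m n : time s <= time (a m) ->
  (forall i, (m <= i < m + n)%N -> time (a i) <= time (b i) <= time t) ->
  (forall i, time (b i) <= time (a i.+1)) ->
  chain s t [seq (a i, b i) | i <- iota m n].
Proof.
move=> + + ba; elim: n m s => //= n ih m s sa ab.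
have /andP[h1 h2] : time (a m) <= time (b m) <= time t.
  by apply: ab; rewrite leqnn addnS ltnS leq_addr.
rewrite sa h1 h2/=; apply: ih => // i /andP[mi im]; apply: ab.
by rewrite (ltnW mi) addnS -addSn.
Qed.

Lemma Vp_chain_var (p : R) f :
  Vp p f = chain_var (fun _ _ => True) p f (time0 R) (time1 R).
Proof.
apply/eqP; rewrite eq_le; apply/andP; split; apply: ge_ereal_sup.
  move=> _ [n [t [tP ->]]].
  pose l := [seq (t i, t i.+1) | i <- iota 0 n].
  have cl : chain (time0 R) (time1 R) l.
    apply: chain_iota => [|i _|i]; first exact: time_ge0.
      by rewrite time_le1 andbT; apply: tP.
    exact: lexx.
  have <- : chain_sum p f l = \sum_(i < n) `|f (t i.+1) - f (t i)| `^ p.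
    by rewrite /chain_sum /l big_map -[RHS](big_mkord xpredT
      (fun i => `|f (t i.+1) - f (t i)| `^ p)) /index_iota subn0.
  by apply: chain_sum_le.
move=> _ [l [cl _] <-].
pose G i := `|f (times l i.+1) - f (times l i)| `^ p.
have -> : chain_sum p f l = \sum_(k < size l) G k.*2.+1.
  by rewrite /chain_sum -(sum_chain_times (fun x y => `|f y - f x| `^ p)).
(* The intervals of the chain are the increments of odd index; those of even index are the gaps,
   which add nonnegative terms. *)
apply: (@le_trans _ _ (\sum_(i < (size l).*2.+1) G i)%:E).
  rewrite lee_fin; elim: (size l) => [|N ih].
    by rewrite big_ord0; apply: sumr_ge0 => i _; exact: powR_ge0.
  rewrite [leLHS]big_ord_recr doubleS [leRHS]big_ord_recr [X in _ <= X + _]big_ord_recr/=.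
  by rewrite [leRHS]addrAC lerD2r; apply: le_trans ih _; rewrite lerDl powR_ge0.
by apply: ereal_sup_ubound; exists (size l).*2.+1, (times l); split => //; exact: times_subdivision.
Qed.

Lemma Vcond_chain_var (q : R) (rho w : I -> R) :
  Vcond q rho w = chain_var (fun x y => w x = w y) q rho (time0 R) (time1 R).
Proof.
apply/eqP; rewrite eq_le; apply/andP; split; apply: ge_ereal_sup.
  move=> _ [n [t [tP wt ->]]].
  pose l := [seq (t k.*2.+1, t k.*2.+2) | k <- iota 0 n].
  have cl : chain (time0 R) (time1 R) l.
    apply: chain_iota => [|i _|i]; first exact: time_ge0.
      by rewrite time_le1 andbT; apply: tP.
    by rewrite doubleS; apply: tP.
  have <- : chain_sum q rho l = \sum_(k < n) `|rho (t k.*2.+2) - rho (t k.*2.+1)| `^ q.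
    by rewrite /chain_sum /l big_map -[RHS](big_mkord xpredT
      (fun k => `|rho (t k.*2.+2) - rho (t k.*2.+1)| `^ q)) /index_iota subn0.
  apply: chain_sum_le => // p /mapP[k]; rewrite mem_iota => /andP[_ kn] -> /=.
  exact: wt.
move=> _ [l [cl Pl] <-].
apply: ereal_sup_ubound; exists (size l), (times l); split => //.
- exact: times_subdivision.
- move=> k /=; elim: l k Pl {cl} => //= p l ih [|k] Pl kl; first exact: (Pl p (mem_head _ _)).
  by apply: ih => // p' p'l; apply: Pl; rewrite inE p'l orbT.
- by rewrite /chain_sum -(sum_chain_times (fun x y => `|rho y - rho x| `^ q)).
Qed.

End chains.

(** * The time interval of a subtree *)

Section end_times.
Context {R : realType} (w : continuousType (unit_itv R) R).
Local Notation I := (unit_itv R).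
Local Notation proj := (tree_proj w).
Implicit Types (s t u v : I) (tau sigma : tree w).

Lemma tanc_repr tau s : proj s = tau -> tanc tau s.
Proof. by move=> <-; exact/tanc_proj/anc_refl. Qed.

Lemma proj_tanc tau s : tanc tau s -> w s = lev tau -> proj s = tau.
Proof.
by move=> ts ws; apply: (tanc_level_inj (tanc_repr erefl) ts); rewrite lev_proj.
Qed.

Lemma fiber_anc tau s t : proj s = tau -> tanc tau t -> anc w s t.
Proof. by move=> <- /tanc_proj. Qed.

(** Fibers are closed, so the infimum and the supremum defining [first_time] and [last_time] are
    attained. *)
Lemma fiber_closed tau e :
  (forall d : R, 0 < d -> exists2 u, proj u = tau & `|time u - time e| < d) ->
  proj e = tau.
Proof.
move=> cl; have we : w e = lev tau.
  apply/eqP/negPn/negP => ne; have [|d d0 hd] := @path_continuous _ w e `|w e - lev tau|.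
    by rewrite normr_gt0 subr_eq0.
  by have [u ut /hd] := cl d d0; rewrite -ut lev_proj distrC ltxx.
apply: proj_tanc => // z; have [->|ze] := eqVneq z e; first by rewrite we.
have d0 : 0 < `|time z - time e| by rewrite normr_gt0 subr_eq0 (inj_eq (@time_inj R)).
(* A time [u] of the fiber closer to [e] than [z] is: then [z] is also between [repr tau] and
   [u]. *)
have [u ut ue] := cl _ d0; move=> /betweenP vez.
apply: (fiber_anc (reprK tau) (tanc_repr ut)); apply/betweenP.
move: ue; rewrite ltr_norml; have [?|?] := ger0P (time z - time e) => /andP[? ?].
  by case: vez => /andP[? ?]; [left|right]; apply/andP; split; lra.
by case: vez => /andP[? ?]; [left|right]; apply/andP; split; lra.
Qed.

Let times_of tau := [set val t | t in proj @^-1` [set tau]].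

Let times_of_ubound tau : has_ubound (times_of tau).
Proof. by exists 1 => _ [t _ <-]; exact: time_le1. Qed.

Let times_of_lbound tau : has_lbound (times_of tau).
Proof. by exists 0 => _ [t _ <-]; exact: time_ge0. Qed.

Let times_of_neq0 tau : times_of tau !=set0.
Proof. exact: (ex_intro _ _ (ex_intro2 _ _ (repr tau) (reprK tau) erefl)). Qed.

Lemma first_timeP tau : proj (first_time tau) = tau /\
  forall u, proj u = tau -> time (first_time tau) <= time u.
Proof.
have fE : time (first_time tau) = inf (times_of tau).
  rewrite /time val_insubd mem_unit_itv//; apply/andP; split.
    by apply: (lb_le_inf (times_of_neq0 tau)) => _ [t _ <-]; exact: time_ge0.
  have [x tx] := times_of_neq0 tau; apply: le_trans (ge_inf (times_of_lbound tau) tx) _.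
  by case: tx => t _ <-; exact: time_le1.
split; last by move=> u ut; rewrite fE; apply: ge_inf => //; exists u.
apply: fiber_closed => d d0.
have [|_ [u ut <-] ud] := @inf_adherent _ (times_of tau) d d0.
  by split; [exact: times_of_neq0|].
exists u => //; rewrite fE ger0_norm ?ltrBlDl// subr_ge0.
by apply: ge_inf => //; exists u.
Qed.

Lemma last_timeP tau : proj (last_time tau) = tau /\
  forall u, proj u = tau -> time u <= time (last_time tau).
Proof.
have fE : time (last_time tau) = sup (times_of tau).
  rewrite /time val_insubd mem_unit_itv//; apply/andP; split; last first.
    by apply: (ge_sup (times_of_neq0 tau)) => _ [t _ <-]; exact: time_le1.
  have [x tx] := times_of_neq0 tau; apply: le_trans (ub_le_sup (times_of_ubound tau) tx).
  by case: tx => t _ <-; exact: time_ge0.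
split; last by move=> u ut; rewrite fE; apply: ub_le_sup => //; exists u.
apply: fiber_closed => d d0.
have [|_ [u ut <-] ud] := @sup_adherent _ (times_of tau) d d0.
  by split; [exact: times_of_neq0|].
exists u => //; rewrite fE distrC ger0_norm ?subr_ge0.
  by rewrite ltrBlDl -ltrBlDr.
by apply: ub_le_sup => //; exists u.
Qed.

Lemma proj_first tau : proj (first_time tau) = tau.
Proof. by have [] := first_timeP tau. Qed.

Lemma proj_last tau : proj (last_time tau) = tau.
Proof. by have [] := last_timeP tau. Qed.

Lemma path_first tau : w (first_time tau) = lev tau.
Proof. by rewrite -[in RHS](proj_first tau) lev_proj. Qed.

Lemma path_last tau : w (last_time tau) = lev tau.
Proof. by rewrite -[in RHS](proj_last tau) lev_proj. Qed.

Lemma first_le_last tau : time (first_time tau) <= time (last_time tau).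
Proof. by apply: (first_timeP tau).2; exact: proj_last. Qed.

(** The times of a subtree form an interval: the segment from [repr tau] to [u] is contained in the
    one to [s] or in the one to [t]. *)
Lemma tanc_convex tau s t u : tanc tau s -> tanc tau t ->
  time s <= time u <= time t -> tanc tau u.
Proof.
move=> ts tt /andP[su ut] z /betweenP vuz.
have [h|h] := leP (time (repr tau)) (time u).
  by apply: tt; apply/betweenP; left; case: vuz => /andP[? ?]; apply/andP; split; lra.
by apply: ts; apply/betweenP; right; case: vuz => /andP[? ?]; apply/andP; split; lra.
Qed.

Lemma tanc_between_ends tau u :
  time (first_time tau) <= time u <= time (last_time tau) -> tanc tau u.
Proof.
by apply: tanc_convex; apply: tanc_repr; [exact: proj_first|exact: proj_last].
Qed.

(* A time outside the subtree separates, by the intermediate value theorem, any time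
   of the subtree from a time of the fiber on the same side. *)
Lemma first_time_le tau z u : ~ tanc tau z -> time z <= time u -> tanc tau u ->
  time (first_time tau) <= time u.
Proof.
move=> nz zu tu; have lu : lev tau <= w u by exact: anc_le tu.
have [y yzu wy] : exists2 y, time z <= time y <= time u & w y < lev tau.
  apply: contrapT => hy; apply: nz => x /(between_split u)[/tu//|].
  rewrite betweenC between_le// => zxu; rewrite leNgt; apply/negP => xl.
  by apply: hy; exists x.
have /andP[zy yu] := yzu.
have [|y' [yuy' wy' y'u]] := @descent _ w u y (lev tau); first by rewrite (ltW wy).
have : time y' <= time u.
  by move: yuy'; rewrite betweenC between_le// => /andP[].
apply: le_trans; apply: (first_timeP tau).2.
by apply: proj_tanc => //; apply: (anc_chain tu y'u); rewrite wy'.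
Qed.

Lemma last_time_ge tau z u : ~ tanc tau z -> time u <= time z -> tanc tau u ->
  time u <= time (last_time tau).
Proof.
move=> nz zu tu; have lu : lev tau <= w u by exact: anc_le tu.
have [y yzu wy] : exists2 y, time u <= time y <= time z & w y < lev tau.
  apply: contrapT => hy; apply: nz => x /(between_split u)[/tu//|].
  rewrite between_le// => zxu; rewrite leNgt; apply/negP => xl.
  by apply: hy; exists x.
have /andP[uy yz] := yzu.
have [|y' [yuy' wy' y'u]] := @descent _ w u y (lev tau); first by rewrite (ltW wy).
have : time u <= time y' by move: yuy'; rewrite between_le// => /andP[].
move=> /le_trans; apply; apply: (last_timeP tau).2.
by apply: proj_tanc => //; apply: (anc_chain tu y'u); rewrite wy'.
Qed.

End end_times.

(** * Disjointness of the time intervals *)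

Section disjoint_excursions.
Context {R : realType} (w : continuousType (unit_itv R) R).
Local Notation I := (unit_itv R).
Local Notation proj := (tree_proj w).
Local Notation "tau ^>" := (first_time tau) (at level 2, format "tau ^>").
Local Notation "tau ^<" := (last_time tau) (at level 2, format "tau ^<").
Implicit Types (s t u v : I) (tau sigma : tree w).

(** Excludes the arcs from the root to the classes of 0 and 1, on which the convention in [Drho]
    replaces a value by 0. Elsewhere the times of the subtree run exactly from [first_time] to
    [last_time]. *)
Definition off_spines tau := ~ tanc tau (time0 R) /\ ~ tanc tau (time1 R).

Definition excursion_in s t tau :=
  [/\ off_spines tau, time s <= time tau^> & time tau^< <= time t].

Lemma tanc_ends tau u : off_spines tau -> tanc tau u ->
  time tau^> <= time u <= time tau^<.
Proof.
move=> [n0 n1] tu; rewrite (first_time_le n0 (time_ge0 u) tu).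
exact: last_time_ge n1 (time_le1 u) tu.
Qed.

(* Above [tau] there is no branch longer than [2 * e], whereas [sigma] starts a branch
   longer than [e] at a level higher by at least [2 * e]. *)
Lemma excursions_disjoint (e : R) tau sigma : 0 < e -> tau != sigma ->
  (exists k : int, lev tau - lev sigma = k%:~R * (2 * e)) ->
  ~ higher (2 * e) tau -> higher e sigma -> ~ tanc tau sigma^>.
Proof.
move=> e0 /eqP ne [k kE] nt [u su hu] ts; have := anc_le ts.
rewrite -/(lev tau) path_first le_eqVlt => /orP[/eqP E|lt].
  by apply: ne; apply: (tanc_level_inj ts _ E); apply: tanc_repr; exact: proj_first.
apply: nt; exists u; last first.
  have k0 : k%:~R < (0 : R).
    by rewrite -(pmulr_llt0 _ (_ : 0 < 2 * e)) ?mulr_gt0// -kE subr_lt0.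
  have k1 : k%:~R <= (-1 : R).
    move: k0; rewrite ltrz0; case: (k) => // n _.
    by rewrite NegzE mulrNz lerN2 ler1n.
  have : k%:~R * (2 * e) <= - (2 * e) by rewrite -mulN1r ler_pM2r// mulr_gt0.
  by rewrite -kE; lra.
apply: anc_trans ts _; exact: fiber_anc (proj_first _) su.
Qed.

End disjoint_excursions.

Lemma powR_le (R : realType) (r x y : R) : 0 <= r -> 0 <= x -> x <= y ->
  x `^ r <= y `^ r.
Proof.
move=> r0 x0 xy; apply: ge0_ler_powR => //; rewrite nnegrE//; exact: le_trans xy.
Qed.

(* Each [x] is at most [z + x ^ q / z ^ (q - 1)] with [z ^ q = Q / N]; up to the factor
   [2] this is Hoelder's inequality. *)
Lemma sum_le_powR (R : realType) (T : eqType) (l : seq T) (x : T -> R) (q N Q : R) :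
  1 <= q -> 0 < N -> (forall i, 0 <= x i) -> (size l)%:R <= N ->
  \sum_(i <- l) x i `^ q <= Q ->
  \sum_(i <- l) x i <= 2 * N * (Q / N) `^ q^-1.
Proof.
move=> q1 N0 x0 lN xQ; have q0 : 0 < q by exact: lt_le_trans q1.
have Q0 : 0 <= Q by apply: le_trans xQ; apply: sumr_ge0 => i _; exact: powR_ge0.
move: Q0; rewrite le_eqVlt => /orP[/eqP Q0|Q0].
  have x0' i : i \in l -> x i = 0.
    move=> il; have : x i `^ q <= 0.
      rewrite Q0; apply: le_trans xQ; rewrite (big_rem i)//= lerDl.
      by apply: sumr_ge0 => j _; exact: powR_ge0.
    by rewrite le_eqVlt ltNge powR_ge0 orbF powR_eq0 => /andP[/eqP].
  rewrite big_seq big1//; rewrite mulr_ge0 ?powR_ge0// mulr_ge0// ltW//.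
pose z := (Q / N) `^ q^-1.
have z0 : 0 < z by rewrite powR_gt0// divr_gt0.
have zq : z `^ q = Q / N by rewrite -powRrM mulVf ?gt_eqF// powRr1// ltW// divr_gt0.
have zq1 : 0 < z `^ (q - 1) by rewrite powR_gt0.
have xz i : x i <= z + x i `^ q / z `^ (q - 1).
  have [xz|zx] := leP (x i) z; first by rewrite ler_wpDr// divr_ge0 ?powR_ge0.
  rewrite ler_wpDl ?(ltW z0)// ler_pdivlMr// -(mulr_powRB1 (x0 i) q0).
  by rewrite ler_wpM2l// powR_le ?subr_ge0// ltW.
have QE : Q / z `^ (q - 1) = N * z.
  apply: (mulIf (lt0r_neq0 zq1)); rewrite divfK ?gt_eqF// -mulrA mulr_powRB1 ?ltW//.
  by rewrite zq mulrC divfK ?gt_eqF.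
apply: le_trans (ler_sum _ (fun i _ => xz i)) _.
rewrite big_split/= -mulr_suml big_const_seq count_predT iter_addr_0 -[z *+ _]mulr_natl.
rewrite -/z (_ : 2 * N * z = N * z + N * z); last by ring.
rewrite lerD//; first by rewrite ler_wpM2r// ltW.
by rewrite -QE ler_wpM2r// invr_ge0 ltW.
Qed.

(** * Sums over a band of heights *)

Section counting.
Context {R : realType} (w : continuousType (unit_itv R) R).
Local Notation I := (unit_itv R).
Local Notation proj := (tree_proj w).
Implicit Types (s t u v : I) (tau sigma : tree w) (l : seq (tree w)).

(** Sorted by their first times, intervals none of which contains the start of another are
    successive. The freedom in [a] and [b] serves two uses: intervals from a first time to a high
    point of the subtree, and whole intervals. *)
Lemma chain_sorted s t l (a b : tree w -> I) :
  (forall tau, [/\ time (first_time tau) <= time (a tau), time (a tau) <= time (b tau)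
     & time (b tau) <= time (last_time tau)]) ->
  (forall tau, tau \in l -> time s <= time (first_time tau) /\ time (last_time tau) <= time t) ->
  uniq l -> pairwise (fun x y => time (first_time x) <= time (first_time y)) l ->
  (forall tau sigma, tau \in l -> sigma \in l -> tau != sigma ->
     ~ tanc tau (first_time sigma)) ->
  chain s t [seq (a tau, b tau) | tau <- l].
Proof.
move=> ab; elim: l s => //= tau l ih s st /andP[taul ul] /andP[/allP al pl] dis.
have [fa ab' bl] := ab tau; have [sf lt] := st _ (mem_head _ _).
rewrite (le_trans sf fa) ab' (le_trans bl lt)/=; apply: ih => //.
  move=> sigma sl; have sl' : sigma \in tau :: l by rewrite inE sl orbT.
  split; last by have [] := st _ sl'.
  apply: le_trans bl _; rewrite leNgt; apply/negP => lt'.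
  apply: (dis tau sigma (mem_head _ _) sl').
    by apply: contraNneq taul => ->.
  by apply: tanc_between_ends; rewrite al// ltW.
by move=> x y xl yl; apply: dis; rewrite inE ?xl ?yl orbT.
Qed.

Lemma band_sum (p q M e Q : R) (rho : I -> R) s t l :
  1 <= p -> 1 <= q -> 0 < M -> 0 < e ->
  (forall m, chain s t m -> chain_sum p w m <= M `^ p) ->
  (forall m, chain s t m -> linked (fun x y => w x = w y) m -> chain_sum q rho m <= Q) ->
  uniq l ->
  (forall tau, tau \in l -> [/\ excursion_in s t tau, higher e tau & ~ higher (2 * e) tau]) ->
  (forall x y, x \in l -> y \in l -> exists k : int, lev x - lev y = k%:~R * (2 * e)) ->
  \sum_(tau <- l) `|rho (first_time tau) - rho (last_time tau)| <=
    2 * ((M / e) `^ p) * (Q / (M / e) `^ p) `^ q^-1.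
Proof.
move=> p1 q1 Mgt0 e0 wM rhoQ ul lP lev_l; have M0 := ltW Mgt0.
pose r (x y : tree w) := time (first_time x) <= time (first_time y).
have r_tr : transitive r by move=> y x z; exact: le_trans.
pose l' := sort r l.
have ll' : perm_eq l' l by rewrite perm_sort.
have ml' x : (x \in l') = (x \in l) by exact: perm_mem.
have pl' : pairwise r l'.
  by rewrite -sorted_pairwise//; apply: sort_sorted => x y; exact: le_total.
have chainl' a b : (forall tau, [/\ time (first_time tau) <= time (a tau),
     time (a tau) <= time (b tau) & time (b tau) <= time (last_time tau)]) ->
    chain s t [seq (a tau, b tau) | tau <- l'].
  move=> ab; apply: chain_sorted => //.
  - by move=> tau; rewrite ml' => /lP[[_ ? ?] _ _].
  - by rewrite (perm_uniq ll').
  - move=> tau sigma; rewrite !ml' => tl sl ne.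
    have [_ _ nh] := lP _ tl; have [_ hs _] := lP _ sl.
    exact: (excursions_disjoint e0 ne (lev_l _ _ tl sl)).
rewrite -(perm_big _ ll').
apply: sum_le_powR => //.
- by rewrite powR_gt0// divr_gt0.
(* Counting: on each interval [w] rises by more than [e] from the first time to some [u]. These
   disjoint increments contribute at least [e ^ p] each to a sum bounded by [M ^ p]. *)
- have /choice[u uP] : forall tau, exists u,
      time (first_time tau) <= time u <= time (last_time tau) /\
      (tau \in l -> lev tau + e < w u).
    move=> tau; case: (boolP (tau \in l)) => [|_]; last first.
      by exists (first_time tau); rewrite lexx first_le_last.
    by move=> /lP[[off _ _] [u tu hu] _]; exists u; split=> //; exact: tanc_ends.
  have cl : chain s t [seq (first_time tau, u tau) | tau <- l'].
    by apply: chainl' => tau; have [/andP[? ?] _] := uP tau; split.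
  have := wM _ cl; rewrite /chain_sum big_map /=.
  rewrite powRM ?invr_ge0 ?(ltW e0)// => h.
  have eE : e^-1 `^ p = (e `^ p)^-1.
    by rewrite -powR_inv1 ?(ltW e0)// -powRrM mulN1r powRN.
  rewrite eE ler_pdivlMr ?powR_gt0//; apply: le_trans h.
  rewrite (_ : (size l')%:R * e `^ p = \sum_(tau <- l') e `^ p); last first.
    by rewrite big_const_seq count_predT iter_addr_0 mulr_natl.
  rewrite !big_seq; apply: ler_sum => tau; rewrite ml' => tl.
  have [_ /(_ tl) hu] := uP tau.
  rewrite powR_le ?(ltW e0) ?(le_trans ler01 p1)// path_first.
  by apply: le_trans (ler_norm _); lra.
(* The whole intervals have equal values of [w] at their ends, so they form an admissible family for
   [rho]. *)
- have cl : chain s t [seq (first_time tau, last_time tau) | tau <- l'].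
    by apply: chainl' => tau; split => //; exact: first_le_last.
  have := rhoQ _ cl; rewrite /chain_sum big_map /=.
  under eq_bigr do rewrite distrC; apply.
  by move=> _ /mapP[tau _ ->] /=; rewrite path_first path_last.
Qed.

End counting.

Lemma geometric_sum_le (R : realType) (r : R) n : 0 <= r < 1 ->
  \sum_(0 <= i < n) r ^+ i <= (1 - r)^-1.
Proof.
move=> /andP[r0 r1]; rewrite -[leRHS]div1r ler_pdivlMr ?subr_gt0// mulrC.
suff -> : (1 - r) * \sum_(0 <= i < n) r ^+ i = 1 - r ^+ n.
  by rewrite gerBl exprn_ge0.
elim: n => [|n ih]; first by rewrite big_nil mulr0 expr0 subrr.
by rewrite big_nat_recr//= mulrDr ih exprS; ring.
Qed.

(** * Summation over the dyadic scale *)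

Section excursion_integral.
Context {R : realType}.
Local Notation I := (unit_itv R).

(* The ratio of the contributions of two successive dyadic heights; it is [< 1]
   exactly when [1 / p + 1 / q > 1]. *)
Definition band_ratio (p q : R) : R := 2 `^ (p * (1 - q^-1) - 1).

(** One factor 2 is the period [2 * e] of the levels, the other comes from [sum_le_powR]; the
    denominator sums the geometric series. *)
Definition young_const (p q : R) : R := 4 / (1 - band_ratio p q).

Lemma band_ratio_lt1 (p q : R) : 1 <= p -> 1 < p^-1 + q^-1 -> band_ratio p q < 1.
Proof.
move=> p1 pq; have p0 : 0 < p by exact: lt_le_trans p1.
have h : p * (1 - q^-1) < 1.
  by rewrite mulrC -ltr_pdivlMr// div1r; lra.
have -> : (1 : R) = 2 `^ 0 by rewrite powRr0.
by rewrite /band_ratio /powR pnatr_eq0/= ltr_expR ltr_pM2r ?ln_gt0 ?ltr1n//; lra.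
Qed.

Lemma young_const_ge0 (p q : R) : 1 <= p -> 1 < p^-1 + q^-1 -> 0 <= young_const p q.
Proof.
by move=> p1 pq; rewrite divr_ge0// subr_ge0 ltW// band_ratio_lt1.
Qed.

(** The left-hand side is the period [2 * e] times the bound of [band_sum], for
    [e = M / 2 ^ (j + 1)]. *)
Lemma band_term (p q M Q : R) (j : nat) : 0 < q -> 0 <= Q ->
  2 * (M / 2 ^+ j.+1) *
    (2 * ((2 ^+ j.+1) `^ p) * (Q / (2 ^+ j.+1) `^ p) `^ q^-1) =
  4 * M * Q `^ q^-1 * band_ratio p q ^+ j.+1.
Proof.
move=> q0 Q0; set B : R := 2 ^+ j.+1.
have B0 : 0 < B by rewrite exprn_gt0.
have BE : B = 2 `^ j.+1%:R by rewrite powR_mulrn.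
have -> : (Q / B `^ p) `^ q^-1 = Q `^ q^-1 * (B `^ (p * q^-1))^-1.
  rewrite powRM ?invr_ge0 ?powR_ge0//; congr (_ * _).
  by rewrite -!powRN -powRrM; congr (_ `^ _); ring.
have -> : band_ratio p q ^+ j.+1 = B `^ p * (B `^ (p * q^-1))^-1 * B^-1.
  rewrite -powRN -(powR_inv1 (ltW B0)) -!powRD ?(gt_eqF B0) ?implybT//.
  rewrite BE -powRrM -powR_mulrn ?powR_ge0// /band_ratio -powRrM.
  by congr (_ `^ _); ring.
by ring.
Qed.

Variables (w : continuousType I R) (U : I)
  (lambda : {measure set (borel_tree w) -> \bar R}).
Hypotheses (minU : is_min_time w U) (lambda_length : is_length_measure (tree_proj w U) lambda).
Local Notation T := (borel_tree w).

Let band M j : set T := higher (M / 2 ^+ j.+1) `&` ~` higher (M / 2 ^+ j).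

Lemma higherS (e e' : R) : e <= e' -> @higher R w e' `<=` higher e.
Proof. by move=> ee' tau [u tu hu]; exists u => //; lra. Qed.

Lemma measurable_band M j : 0 < M -> measurable (band M j).
Proof.
by move=> M0; apply: measurableI; [|apply: measurableC];
  apply: measurable_higher minU _ _; rewrite divr_ge0 ?exprn_ge0// ltW.
Qed.

Lemma trivIset_band M : 0 < M -> trivIset setT (band M).
Proof.
move=> M0 i j _ _; wlog : i j / (i < j)%N => [wl|ij [tau [[ti _] [_ tj]]]].
  have [ij|ij|//] := ltngtP i j; first exact: wl.
  by rewrite setIC => /(wl _ _ ij).
exfalso; apply: tj; apply: higherS ti.
by rewrite ler_pM2l// lef_pV2 ?posrE ?exprn_gt0// ler_eXn2l// ltr1n.
Qed.

Lemma band_cover M tau : 0 < M -> higher 0 tau -> ~ higher M tau ->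
  exists j, band M j tau.
Proof.
move=> M0 [u tu]; rewrite addr0 => hu nM.
have ex : exists j, `[< higher (M / 2 ^+ j.+1) tau >].
  have gap : 0 < w u - lev tau by rewrite subr_gt0.
  pose n := (Num.truncn (M / (w u - lev tau))).+1.
  exists n; apply/asboolP; exists u => //; rewrite -ltrBrDl.
  rewrite ltr_pdivrMr ?exprn_gt0// mulrC -ltr_pdivrMr//.
  apply: lt_trans (truncnS_gt _) _; rewrite -/n.
  by rewrite -natrX ltr_nat (leq_trans (ltn_expl n (ltnSn 1)))// leq_exp2l.
case: (ex_minnP ex) => j /asboolP hj jmin; exists j; split=> //.
case: j hj jmin => [|j] hj jmin; first by rewrite expr0 divr1.
by move=> /asboolP /jmin; rewrite ltnn.
Qed.

(** Stated for a function [f] dominated by the jump of [rho], so that it applies both to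
    restrictions of [Drho] and to simple functions below it. *)
Lemma excursion_integral (p q M Q : R) (rho : I -> R) (s t : I) (f : T -> \bar R) :
  1 <= p -> 1 <= q -> 1 < p^-1 + q^-1 -> 0 < M -> 0 <= Q ->
  (forall m, chain s t m -> chain_sum p w m <= M `^ p) ->
  (forall m, chain s t m -> linked (fun x y => w x = w y) m -> chain_sum q rho m <= Q) ->
  measurable_fun setT f -> (forall tau, 0 <= f tau)%E ->
  (forall tau, f tau <= `|rho (first_time tau) - rho (last_time tau)|%:E)%E ->
  (forall tau, ~ excursion_in s t tau -> f tau = 0%E) ->
  (\int[lambda]_tau f tau <= (young_const p q * M * Q `^ q^-1)%:E)%E.
Proof.
move=> p1 q1 pq M0 Q0 wM rhoQ mf f0 frho fout.
have mB j : measurable (band M j) by exact: measurable_band.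
(* [M] bounds every increment of [w] on [[s, t]], so no excursion is higher than [M] and the dyadic
   scale starts at [M]. *)
have fM tau : higher M tau -> f tau = 0%E.
  move=> [u tu hu]; apply: fout => -[off sf lt].
  have /andP[fu ul] := tanc_ends off tu.
  have := wM [:: (first_time tau, u)].
  rewrite /= sf fu (le_trans ul lt) => /(_ isT); rewrite /chain_sum big_seq1/=.
  rewrite path_first leNgt => /negP; apply.
  apply: gt0_ltr_powR; rewrite ?nnegrE ?(ltW M0)//; first exact: lt_le_trans p1.
  by apply: lt_le_trans (ler_norm _); lra.
rewrite (integral_higher minU lambda_length)//.
have -> : (\int[lambda]_(tau in higher 0) f tau = \int[lambda]_(tau in \bigcup_j band M j) f tau)%E.
  rewrite integral_mkcond [RHS]integral_mkcond; congr integral; apply/funext => tau.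
  rewrite /patch; case: ifPn => [/set_mem h0|/negP nh0].
    case: ifPn => // nB; apply: fM; apply: contrapT => nM.
    have [j Bj] := band_cover M0 h0 nM.
    by move/negP : nB; apply; apply/mem_set; exists j.
  rewrite ifF//; apply/negP => /set_mem[j _ [hj _]]; apply: nh0; apply/mem_set.
  by apply: higherS hj; rewrite divr_ge0 ?exprn_ge0// ltW.
rewrite ge0_integral_bigcup//; last 2 first.
- exact: measurable_funS mf.
- exact: trivIset_band.
have term j : (\int[lambda]_(tau in band M j) f tau <=
    (4 * M * Q `^ q^-1 * band_ratio p q ^+ j.+1)%:E)%E.
  rewrite integral_mkcond -(@band_term p q M Q j) ?(lt_le_trans _ q1)//.
  have e0 : 0 < M / 2 ^+ j.+1 by rewrite divr_gt0// exprn_gt0.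
  have eE : M / (M / 2 ^+ j.+1) = 2 ^+ j.+1.
    by rewrite invfM invrK mulrA divff ?gt_eqF// mul1r.
  have e2 : 2 * (M / 2 ^+ j.+1) = M / 2 ^+ j.
    rewrite exprS invfM mulrCA; congr (_ * _).
    by rewrite mulrA divff ?mul1r // pnatr_eq0.
  apply: (level_bound minU lambda_length).
  - by rewrite mulr_gt0.
  - by rewrite !mulr_ge0 ?powR_ge0.
  - by apply/(measurable_restrictT _ (mB j)); exact: measurable_funS mf.
  - by move=> tau; rewrite erestrict_ge0.
  move=> l ul _ lvl.
  pose ok tau := `[< band M j tau /\ excursion_in s t tau >].
  rewrite (bigID ok)/= [X in (_ + X)%E]big1 ?adde0; last first.
    move=> tau /asboolPn nok; rewrite /patch; case: ifPn => // /set_mem Bt.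
    by apply: fout => et; exact: nok.
  apply: (@le_trans _ _ (\sum_(tau <- [seq x <- l | ok x])
      `|rho (first_time tau) - rho (last_time tau)|)%:E).
    rewrite -sumEFin big_filter; apply: lee_sum => tau _.
    by rewrite /patch; case: ifPn => // _; rewrite lee_fin.
  rewrite lee_fin.
  have := @band_sum _ w p q M (M / 2 ^+ j.+1) Q rho s t [seq x <- l | ok x]
    p1 q1 M0 e0 wM rhoQ.
  rewrite eE; apply.
  - by rewrite filter_uniq.
  - move=> tau; rewrite mem_filter => /andP[/asboolP[[h1 h2] h3] _].
    by split => //; rewrite e2.
  - by move=> x y; rewrite !mem_filter => /andP[_ xl] /andP[_ yl]; exact: lvl.
have rP : 0 <= band_ratio p q < 1 by rewrite powR_ge0 band_ratio_lt1.
have /andP[r0 r1] := rP.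
apply: lime_le; first by apply: is_cvg_nneseries => n _ _; exact: integral_ge0.
apply: nearW => n.
apply: (@le_trans _ _ (\sum_(0 <= j < n) (4 * M * Q `^ q^-1 * band_ratio p q ^+ j.+1))%:E).
  by rewrite -sumEFin; apply: lee_sum => j _; exact: term.
have c0 : 0 <= 4 * M * Q `^ q^-1 by rewrite !mulr_ge0 ?powR_ge0// ltW.
rewrite lee_fin -mulr_sumr.
have -> : young_const p q * M * Q `^ q^-1 = 4 * M * Q `^ q^-1 * (1 - band_ratio p q)^-1.
  by rewrite /young_const; ring.
rewrite ler_wpM2l//; apply: le_trans (geometric_sum_le n rP).
by apply: ler_sum => j _; rewrite exprS ler_piMl ?exprn_ge0// ltW.
Qed.

End excursion_integral.

Lemma powR_leV (R : realType) (q x Q : R) : 0 < q -> 0 <= x -> x `^ q <= Q -> x <= Q `^ q^-1.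
Proof.
move=> q0 x0 h; have -> : x = (x `^ q) `^ q^-1 by rewrite -powRrM divff ?gt_eqF// powRr1.
by apply: powR_le => //; [rewrite invr_ge0 ltW|exact: powR_ge0].
Qed.

(** * Increments of the tree integral *)

Section increments.
Context {R : realType} (w : continuousType (unit_itv R) R).
Local Notation I := (unit_itv R).
Local Notation proj := (tree_proj w).
Local Notation T := (borel_tree w).
Variables (U : I) (lambda : {measure set T -> \bar R}).
Hypotheses (minU : is_min_time w U) (lambda_length : is_length_measure (proj U) lambda).
Implicit Types (s t u c : I) (rho : I -> R) (tau : tree w).

Lemma DrhoE rho tau : Drho (proj U) rho tau =
  (if `[< tanc tau (time0 R) >] then 0 else rho (first_time tau)) -
  (if `[< tanc tau (time1 R) >] then 0 else rho (last_time tau)).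
Proof.
rewrite /Drho.
have E s : (tau \in tree_arc (proj U) (proj s)) = `[< tanc tau s >].
  by apply/idP/asboolP => [/set_mem/(arc_rootE minU)//|h]; apply/mem_set/(arc_rootE minU).
by rewrite !E.
Qed.

Lemma restr_itvE s t rho u :
  restr_itv s t rho u = if time s < time u <= time t then rho u else 0.
Proof. by []. Qed.

Lemma Drho_le rho (S : R) tau : (forall u, `|rho u| <= S) -> `|Drho (proj U) rho tau| <= 2 * S.
Proof.
move=> rS; have S0 : 0 <= S by apply: le_trans (rS U).
rewrite DrhoE mulr_natl mulr2n; apply: le_trans (ler_normB _ _) _.
by apply: lerD; case: ifP => // _; rewrite normr0.
Qed.

Lemma restr_itv_le s t rho (S : R) : (forall u, `|rho u| <= S) ->
  forall u, `|restr_itv s t rho u| <= S.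
Proof.
by move=> rS u; rewrite restr_itvE; case: ifP => // _; rewrite normr0 (le_trans _ (rS u)).
Qed.

Variables (s t c : I).
Hypotheses (st : time s <= time t) (sct : between s t c) (cs : anc w c s) (ct : anc w c t).
Let arcs : set T := tree_arc (proj c) (proj s).
Let arct : set T := tree_arc (proj c) (proj t).

Let sc : time s <= time c. Proof. by move: sct; rewrite between_le// => /andP[]. Qed.
Let tc : time c <= time t. Proof. by move: sct; rewrite between_le// => /andP[]. Qed.

Lemma meet_min u : time s <= time u <= time t -> w c <= w u.
Proof.
move=> /andP[su ut]; have [h|h] := leP (time u) (time c).
  by apply: cs; rewrite betweenC between_le// su.
by apply: ct; rewrite between_le// ut ltW.
Qed.

(** If [first_time tau] is in []s, t]] and the subtree is not finished by [t], then [t] belongs to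
    the subtree and [tau] is on the arc to [t]. Symmetrically, a last time in []s, t]] puts [tau] on
    the arc to [s]. *)
Lemma Drho_out rho tau : ~ excursion_in s t tau -> ~ arcs tau -> ~ arct tau ->
  Drho (proj U) (restr_itv s t rho) tau = 0.
Proof.
move=> nex ns nt; rewrite DrhoE.
have ancc v : tanc tau v -> anc w c v -> w c <= lev tau -> anc w c (repr tau).
  by move=> tv cv; exact: (anc_chain cv tv).
have -> : (if `[< tanc tau (time0 R) >] then 0 else restr_itv s t rho (first_time tau)) = 0.
  case: asboolP => // n0; rewrite restr_itvE; case: ifPn => // /andP[sf ft]; exfalso.
  have fl : w c <= lev tau by rewrite -path_first meet_min// (ltW sf).
  suff tt : tanc tau t by apply: nt; apply/(tree_arcE _ ct); split => //; exact: ancc tt ct fl.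
  have tf : tanc tau (first_time tau) by apply: tanc_repr; exact: proj_first.
  have [t1|n1] := pselect (tanc tau (time1 R)).
    by apply: (tanc_convex tf t1); rewrite ft time_le1.
  have [lt|tl] := leP (time (last_time tau)) (time t).
    by exfalso; apply: nex; split => //; exact: ltW.
  by apply: tanc_between_ends; rewrite ft ltW.
have -> : (if `[< tanc tau (time1 R) >] then 0 else restr_itv s t rho (last_time tau)) = 0.
  case: asboolP => // n1; rewrite restr_itvE; case: ifPn => // /andP[sl lt]; exfalso.
  have fl : w c <= lev tau by rewrite -path_last meet_min// (ltW sl).
  suff ts : tanc tau s by apply: ns; apply/(tree_arcE _ cs); split => //; exact: ancc ts cs fl.
  have tl : tanc tau (last_time tau) by apply: tanc_repr; exact: proj_last.
  have [t0|n0] := pselect (tanc tau (time0 R)).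
    by apply: (tanc_convex t0 tl); rewrite (ltW sl) time_ge0.
  have [sf|fs] := leP (time s) (time (first_time tau)).
    by exfalso; apply: nex; split.
  by apply: tanc_between_ends; rewrite (ltW sl) ltW.
by rewrite subrr.
Qed.

(** Since the restriction is to []s, t]], an excursion starting exactly at [s] would lose its first
    value; such a point is the class of [s], which is on [arcs]. *)
Lemma Drho_in rho tau : excursion_in s t tau -> ~ arcs tau ->
  Drho (proj U) (restr_itv s t rho) tau = rho (first_time tau) - rho (last_time tau).
Proof.
move=> [[n0 n1] sf lt] ns; rewrite DrhoE; do 2 (case: asboolP => // _).
have sf' : time s < time (first_time tau).
  rewrite lt_neqAle sf andbT; apply/negP => /eqP /time_inj e; apply: ns.
  apply/(tree_arcE _ cs); have ps : proj s = tau by rewrite e proj_first.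
  split; last exact: tanc_repr.
  by rewrite -ps; apply: (anc_trans cs); exact: fiber_anc erefl (tanc_repr (repr_proj w s)).
have fl := first_le_last tau.
by rewrite !restr_itvE sf' (le_trans fl lt) (lt_le_trans sf' fl) lt.
Qed.

Lemma arcs_meet tau : arcs tau -> arct tau -> tau = proj c.
Proof.
move=> /(tree_arcE _ cs)[ctau ts] /(tree_arcE _ ct)[_ tt].
have tc' : tanc tau c by apply: (tanc_convex ts tt); rewrite sc tc.
by rewrite -[tau]reprK; apply/proj_ancP.
Qed.

(** The subtree of [tau] contains [s] but not [c]: its first value is cut off by the restriction, or
    by the convention in [Drho], and its last time falls between [s] and [c]. The strict bound
    [lev tau < w s] keeps the last time away from [s]. [Drho_right] is the mirror case. *)
Lemma Drho_left rho tau : tanc tau s -> w c < lev tau < w s ->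
  [/\ Drho (proj U) (restr_itv s t rho) tau = - rho (last_time tau) &
      time s <= time (last_time tau) <= time c].
Proof.
move=> ts /andP[cl ls].
have nc : ~ tanc tau c by move=> /anc_le; rewrite leNgt cl.
have n1 : ~ tanc tau (time1 R).
  by move=> t1; apply: nc; apply: (tanc_convex ts t1); rewrite sc time_le1.
have tl : tanc tau (last_time tau) by apply: tanc_repr; exact: proj_last.
have sl : time s < time (last_time tau).
  rewrite lt_neqAle (last_time_ge n1 (time_le1 s) ts) andbT; apply/negP => /eqP /time_inj e.
  by move: ls; rewrite {1}e path_last ltxx.
have lc : time (last_time tau) < time c.
  rewrite ltNge; apply/negP => cl'; apply: nc; apply: (tanc_convex ts tl).
  by rewrite sc cl'.
split; last by rewrite !ltW.
rewrite DrhoE; case: (asboolP (tanc tau (time1 R))) => // _.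
rewrite [X in _ - X]restr_itvE sl (le_trans (ltW lc) tc)/=.
case: asboolP => [_|n0]; first by rewrite sub0r.
by rewrite restr_itvE ltNge (first_time_le n0 (time_ge0 s) ts)/= sub0r.
Qed.

Lemma Drho_right rho tau : tanc tau t -> w c < lev tau < w t ->
  [/\ Drho (proj U) (restr_itv s t rho) tau = rho (first_time tau) &
      time c <= time (first_time tau) <= time t].
Proof.
move=> tt /andP[cl lt].
have nc : ~ tanc tau c by move=> /anc_le; rewrite leNgt cl.
have n0 : ~ tanc tau (time0 R).
  by move=> t0; apply: nc; apply: (tanc_convex t0 tt); rewrite tc time_ge0.
have tf : tanc tau (first_time tau) by apply: tanc_repr; exact: proj_first.
have ft : time (first_time tau) <= time t by exact: first_time_le n0 (time_ge0 t) tt.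
have cf : time c < time (first_time tau).
  rewrite ltNge; apply/negP => fc; apply: nc; apply: (tanc_convex tf tt).
  by rewrite tc fc.
split; last by rewrite ltW.
rewrite DrhoE; case: (asboolP (tanc tau (time0 R))) => // _.
rewrite [X in X - _]restr_itvE (le_lt_trans sc cf) ft/=.
case: asboolP => [_|n1]; first by rewrite subr0.
rewrite restr_itvE [X in _ && X]leNgt.
suff -> : time t < time (last_time tau) by rewrite andbF subr0.
rewrite lt_neqAle (last_time_ge n1 (time_le1 t) tt) andbT; apply/negP => /eqP /time_inj e.
by move: lt; rewrite {1}e path_last ltxx.
Qed.

Variables (p q M Q S : R) (rho : I -> R).
Hypotheses (p1 : 1 <= p) (q1 : 1 <= q) (pq : 1 < p^-1 + q^-1) (M0 : 0 < M) (Q0 : 0 <= Q).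
Hypothesis wM : forall m, chain s t m -> chain_sum p w m <= M `^ p.
Hypothesis rhoQ : forall m, chain s t m ->
  linked (fun x y => w x = w y) m -> chain_sum q rho m <= Q.
Hypothesis rhoS : forall u, `|rho u| <= S.
Let D : T -> R := Drho (proj U) (restr_itv s t rho).
Hypothesis mD : measurable_fun setT D.

Let p0 : 0 < p. Proof. exact: lt_le_trans p1. Qed.
Let q0 : 0 < q. Proof. exact: lt_le_trans q1. Qed.

Let gap_le x y : chain s t [:: (x, y)] -> `|w y - w x| <= M.
Proof.
move=> /wM; rewrite /chain_sum big_seq1/= => h; have := powR_leV p0 (normr_ge0 _) h.
by rewrite -powRrM divff ?gt_eqF// powRr1// ltW.
Qed.

Let wcs : w s - w c <= M.
Proof.
have := @gap_le s c; rewrite /= lexx sc tc distrC => /(_ isT).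
exact: le_trans (ler_norm _).
Qed.

Let wct : w t - w c <= M.
Proof.
have := @gap_le c t; rewrite /= lexx sc tc => /(_ isT).
exact: le_trans (ler_norm _).
Qed.

Let marcs : measurable arcs. Proof. exact: measurable_tree_arc. Qed.
Let marct : measurable arct. Proof. exact: measurable_tree_arc. Qed.
Let march : measurable (arcs `|` arct). Proof. exact: measurableU. Qed.

Let mabsD : measurable_fun setT (fun tau : T => (`|D tau|)%:E).
Proof. by apply/measurable_EFinP; apply: measurableT_comp. Qed.

Lemma integral_off_arcs :
  (\int[lambda]_(tau in ~` (arcs `|` arct)) `|D tau|%:E <=
   (young_const p q * M * Q `^ q^-1)%:E)%E.
Proof.
rewrite integral_mkcond.
have outE tau : ~ (arcs `|` arct) tau ->
    D tau = if `[< excursion_in s t tau >] then rho (first_time tau) - rho (last_time tau) else 0.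
  move=> /not_orP[ns nt]; case: asboolP => [ex|nex]; first exact: Drho_in.
  exact: Drho_out.
apply: (excursion_integral minU lambda_length p1 q1 pq M0 Q0 wM rhoQ).
- apply/(measurable_restrictT _ (measurableC march)); exact: measurable_funS mabsD.
- by move=> tau; rewrite erestrict_ge0.
- move=> tau; rewrite /patch; case: ifPn => [/set_mem/outE ->|_]; last by rewrite lee_fin.
  by case: asboolP => // _; rewrite normr0 lee_fin.
- move=> tau nex; rewrite /patch; case: ifPn => // /set_mem/outE ->.
  by case: asboolP => //; rewrite normr0.
Qed.

Let S0 : 0 <= S. Proof. exact: le_trans (rhoS s). Qed.

Let arcs_length : lambda arcs = (w s - w c)%:E.
Proof. by rewrite lambda_length.2 mdist_tree_proj; congr (_%:E); exact/delta_ancP. Qed.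

Let arct_length : lambda arct = (w t - w c)%:E.
Proof. by rewrite lambda_length.2 mdist_tree_proj; congr (_%:E); exact/delta_ancP. Qed.

Let Dle tau : `|D tau| <= 2 * S.
Proof. by apply: Drho_le; exact: restr_itv_le. Qed.

(** The term [4 * S] comes from the arcs: [Drho] is at most [2 * S] there, and each of the two
    branches has length at most [M]. *)
Lemma integral_increment_le :
  (\int[lambda]_tau `|D tau|%:E <= ((young_const p q * Q `^ q^-1 + 4 * S) * M)%:E)%E.
Proof.
rewrite -(setUv (arcs `|` arct)) ge0_integral_setU//; last 3 first.
- exact: measurableC.
- by rewrite setUv.
- by rewrite disj_set2E setICr.
have -> : (young_const p q * Q `^ q^-1 + 4 * S) * M =
    4 * S * M + young_const p q * M * Q `^ q^-1 by ring.
rewrite EFinD; apply: leeD; last exact: integral_off_arcs.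
apply: (@le_trans _ _ (\int[lambda]_(tau in arcs `|` arct) (cst (2 * S)%:E tau))%E).
  apply: ge0_le_integral => //; first exact: measurable_funS mabsD.
  by move=> tau _; rewrite lee_fin.
rewrite integral_cst//; apply: (@le_trans _ _ ((2 * S)%:E * (lambda arcs + lambda arct))%E).
  by apply: lee_pmul => //; [rewrite lee_fin mulr_ge0|exact: measureU2].
rewrite arcs_length arct_length -EFinD -EFinM lee_fin.
have -> : 4 * S * M = 2 * S * (M + M) by ring.
by rewrite ler_wpM2l ?mulr_ge0// lerD.
Qed.

Lemma integrable_increment : lambda.-integrable setT (EFin \o D).
Proof.
apply/integrableP; split; first exact/measurable_EFinP.
apply: le_lt_trans (ltry _); exact: integral_increment_le.
Qed.

(** Signed form of [arc_pushforward], by positive and negative parts. The ends are dropped because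
    the values of [Drho] on the branches are known strictly between the end levels. *)
Let arc_int v (g : R -> tree w) : anc w c v -> geodesic_up c v g ->
  (\int[lambda]_(tau in tree_arc (proj c) (proj v)) (D tau)%:E =
   \int[@lebesgue_measure R]_(y in `]0%R, (w v - w c)%R[) (D (g y))%:E)%E.
Proof.
move=> cv gP; rewrite integralE [RHS]integralE.
have mg : measurable_fun [set: R] (g : R -> T) by exact: measurable_geodesic_up gP.
have mDg : measurable_fun [set: R] (D \o g) by exact: (measurableT_comp mD mg).
have mED : measurable_fun setT (EFin \o D) by exact/measurable_EFinP.
have mEDg : measurable_fun [set: R] (EFin \o (D \o g)) by exact/measurable_EFinP.
congr (_ - _)%E.
  rewrite (arc_pushforward lambda_length.2 cv gP)//; last exact: measurable_funepos.
  rewrite integral_itv_bndoo; first by apply: eq_integral => y _; rewrite ?funeposE ?funenegE.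
  by apply: measurable_funS (measurableT_comp (measurable_funepos mED) mg).
rewrite (arc_pushforward lambda_length.2 cv gP)//; last exact: measurable_funeneg.
rewrite integral_itv_bndoo; first by apply: eq_integral => y _; rewrite ?funeposE ?funenegE.
by apply: measurable_funS (measurableT_comp (measurable_funeneg mED) mg).
Qed.

Lemma integral_increment_level : w s = w t ->
  (`|\int[lambda]_tau (D tau)%:E| <= ((young_const p q + 1) * M * Q `^ q^-1)%:E)%E.
Proof.
move=> wst; have iD := integrable_increment.
have iDS (E : set T) : measurable E -> lambda.-integrable E (EFin \o D).
  by move=> mE; exact: integrableS iD.
have mED : measurable_fun setT (EFin \o D) by exact/measurable_EFinP.
rewrite -(setUv (arcs `|` arct)) integral_setU//; last 3 first.
- exact: measurableC.
- by rewrite setUv.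
- by rewrite disj_set2E setICr.
apply: le_trans (lee_abs_add _ _) _.
have -> : (young_const p q + 1) * M * Q `^ q^-1 =
    M * Q `^ q^-1 + young_const p q * M * Q `^ q^-1 by ring.
rewrite EFinD; apply: leeD; last first.
  apply: le_trans integral_off_arcs.
  apply: le_abse_integral => //; first exact: measurableC.
  exact: measurable_funS mED.
(* The branch point is removed from one of the branches to make them disjoint; it is negligible. *)
have marct' : measurable (arct `\` [set proj c] : set T).
  by apply: measurableD => //; exact: measurable_tree_point.
have -> : arcs `|` arct = arcs `|` (arct `\` [set proj c]).
  apply/seteqP; split=> tau [|]; try by left.
    move=> at_; have [->|/eqP ne] := eqVneq tau (proj c); last by right; split.
    left; apply/(tree_arcE _ cs); have /proj_ancP[h1 h2] := repr_proj w c.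
    by split; [exact: h2|exact: anc_trans h1 cs].
  by move=> [h _]; right.
rewrite integral_setU//; last 2 first.
- exact: measurable_funS mED.
- rewrite disj_set2E; apply/eqP; rewrite -subset0 => tau [at_ [/(arcs_meet at_) e]].
  exact.
rewrite -(@negligible_integral _ _ _ _ arct [set proj c])//; last 3 first.
- exact: measurable_tree_point.
- exact: iDS.
- exact: lambda_point lambda_length.2 _.
have [gs gsP] := geodesic_up_exists cs; have [gt gtP] := geodesic_up_exists ct.
rewrite (arc_int cs gsP) (arc_int ct gtP) -wst.
set L := w s - w c; pose E : set (measurableTypeR R) := `]0, L[%classic.
have mE : measurable E by exact: measurable_itv.
have L0 : 0 <= L by rewrite subr_ge0 anc_le.
have lE : (lebesgue_measure E <= L%:E)%E.
  rewrite lebesgue_measure_itv/= lte_fin; case: ifPn => _; last by rewrite lee_fin.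
  by rewrite -EFinB subr0.
have iDg g v : anc w c v -> geodesic_up c v g ->
    (@lebesgue_measure R).-integrable E (fun y => (D (g y))%:E).
  move=> cv gP; have mg : measurable_fun [set: R] (g : R -> T) by exact: measurable_geodesic_up gP.
  have mDg : measurable_fun [set: R] (D \o g) by exact: (measurableT_comp mD mg).
  apply/integrableP; split.
    by apply: (@measurable_funS _ _ _ _ setT) => //; exact/measurable_EFinP.
  apply: (@le_lt_trans _ _ (\int[@lebesgue_measure R]_(y in E) (cst (2 * S)%:E y))%E).
    apply: ge0_le_integral => //; last by move=> y _; rewrite lee_fin.
    apply: (@measurable_funS _ _ _ _ setT) => //.
    by apply/measurable_EFinP; apply: measurableT_comp.
  rewrite integral_cst//; apply: lte_mul_pinfty => //; first by rewrite lee_fin mulr_ge0.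
  exact: le_lt_trans lE (ltry _).
rewrite -integralD//; [|exact: iDg gsP|exact: iDg gtP].
have iDD := integrableD mE (iDg _ _ cs gsP) (iDg _ _ ct gtP).
apply: le_trans (le_abse_integral _ mE (measurable_int _ iDD)) _.
apply: (@le_trans _ _ (\int[@lebesgue_measure R]_(y in E) (cst (Q `^ q^-1)%:E y))%E).
  apply: ge0_le_integral => //.
    by apply: measurableT_comp => //; exact: (measurable_int _ iDD).
  move=> y; rewrite /E /= in_itv/= => /andP[y0 yL].
  have yL' : 0 <= y <= L by rewrite !ltW.
  have [_ ss ls] := gsP y; have [_ tt lt] := gtP y.
  rewrite clamp_id// in ls; rewrite -wst clamp_id// in lt.
  have hs : w c < lev (gs y) < w s by rewrite ls ltrDl y0 -ltrBrDl.
  have ht : w c < lev (gt y) < w t by rewrite lt ltrDl y0 -wst -ltrBrDl.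
  have [e1 /andP[h1 h2]] := Drho_left rho ss hs.
  have [e2 /andP[h3 h4]] := Drho_right rho tt ht.
  have -> : D (gs y) + D (gt y) = rho (first_time (gt y)) - rho (last_time (gs y)).
    by rewrite /D e1 e2 addrC.
  (* A single admissible pair, one time on each side of [c], bounds the increment by [Q ^ (1/q)];
     integrated over a length at most [M], this gives the [+ 1] in the constant. *)
  rewrite lee_fin; apply: powR_leV => //.
  have := rhoQ (m := [:: (last_time (gs y), first_time (gt y))]).
  rewrite /= h1 h4 (le_trans h2 h3) => /(_ isT).
  rewrite /chain_sum big_seq1/=; apply.
  by move=> _ /[!inE] /eqP -> /=; rewrite path_last path_first ls lt.
rewrite integral_cst// mulrC EFinM; apply: lee_pmul => //; rewrite ?lee_fin ?powR_ge0//.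
by apply: le_trans lE _; rewrite lee_fin; exact: wcs.
Qed.

End increments.

Lemma bounded_fun_bound (R : realType) (T : Type) (f : T -> R) :
  bounded_fun f <-> exists S : R, forall t, `|f t| <= S.
Proof.
split=> [/ex_strict_bound_gt0[S _ h]|[S h]]; first by exists S => t; exact/ltW/h.
by exists S; split; [exact: num_real|move=> x Sx t _ /=; rewrite (le_trans (h t)) ?ltW].
Qed.

Lemma abs_fine_le (R : realType) (x : \bar R) : (`|fine x|%:E <= `|x|)%E.
Proof. by case: x => [r| |] //=; rewrite normr0 leey. Qed.

(** * Finite variations as superadditive functions of intervals *)

Section real_chain_var.
Context {R : realType}.
Local Notation I := (unit_itv R).
Variables (P : I -> I -> Prop) (q : R) (f : I -> R).
Hypothesis fin : (chain_var P q f (time0 R) (time1 R) < +oo)%E.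

Definition rvar s t : R := fine (chain_var P q f s t).

Lemma rvarE s t : (rvar s t)%:E = chain_var P q f s t.
Proof.
rewrite fineK// ge0_fin_numE ?chain_var_ge0//; apply: le_lt_trans fin.
by apply: chain_varS; [exact: time_ge0|exact: time_le1].
Qed.

Lemma rvar_ge0 s t : 0 <= rvar s t.
Proof. by rewrite fine_ge0 ?chain_var_ge0. Qed.

Lemma chain_sum_rvar s t l : chain s t l -> linked P l -> chain_sum q f l <= rvar s t.
Proof. by move=> cl Pl; rewrite -lee_fin rvarE; exact: chain_sum_le. Qed.

Lemma rvar_superadditive s t l : chain s t l ->
  \sum_(x <- l) rvar x.1 x.2 <= rvar s t.
Proof.
move=> cl; rewrite -lee_fin -sumEFin rvarE; under eq_bigr do rewrite rvarE.
exact: chain_var_superadditive.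
Qed.

Lemma rvarS s t s' t' : time s' <= time s -> time t <= time t' -> rvar s t <= rvar s' t'.
Proof. by move=> ss tt; rewrite -lee_fin !rvarE; exact: chain_varS. Qed.

End real_chain_var.

(* Superadditivity of the right-hand side turns a bound on increments into a bound on
   the variation. *)
Lemma chain_var_le (R : realType) (P P' : unit_itv R -> unit_itv R -> Prop)
    (q q' c : R) (f f' : unit_itv R -> R) :
  (chain_var P' q' f' (time0 R) (time1 R) < +oo)%E -> 0 <= c ->
  (forall s t, time s <= time t -> P s t -> `|f t - f s| `^ q <= c * rvar P' q' f' s t) ->
  (chain_var P q f (time0 R) (time1 R) <=
   (c * rvar P' q' f' (time0 R) (time1 R))%:E)%E.
Proof.
move=> fin c0 h; apply: ge_ereal_sup => _ [l [cl Pl] <-]; rewrite lee_fin.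
apply: le_trans (ler_wpM2l c0 (rvar_superadditive fin cl)).
rewrite mulr_sumr /chain_sum !big_seq; apply: ler_sum => p pl; apply: h; last exact: Pl.
move: cl pl; clear; move: (time0 R) (time1 R) => s t; elim: l s => //= p' l ih s.
by move=> /and4P[_ h2 _ h4]; rewrite inE => /orP[/eqP ->|/(ih _ h4)].
Qed.

(** * Integrability, and increments of the integral *)

Section tree_integral_bounds.
Import HBNNSimple.
Context {R : realType} (w : continuousType (unit_itv R) R).
Local Notation I := (unit_itv R).
Local Notation proj := (tree_proj w).
Local Notation T := (borel_tree w).
Variables (U : I) (lambda : {measure set T -> \bar R}).
Hypotheses (minU : is_min_time w U) (lambda_length : is_length_measure (proj U) lambda).
Variables (p q S : R) (rho : I -> R).
Hypotheses (p1 : 1 <= p) (q1 : 1 <= q) (pq : 1 < p^-1 + q^-1).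
Hypothesis rhoS : forall u, `|rho u| <= S.
Local Notation free := (fun _ _ : I => True).
Local Notation level := (fun x y : I => w x = w y).
Hypothesis wfin : (Vp p w < +oo)%E.
Hypothesis rhofin : (Vcond q rho w < +oo)%E.
Let P s t := rvar free p w s t.
Let Q s t := rvar level q rho s t.
Let p0 : 0 < p. Proof. exact: lt_le_trans p1. Qed.
Let q0 : 0 < q. Proof. exact: lt_le_trans q1. Qed.
Let S0 : 0 <= S. Proof. exact: le_trans (rhoS U). Qed.

Let wfin' : (chain_var free p w (time0 R) (time1 R) < +oo)%E.
Proof. by rewrite -Vp_chain_var. Qed.

Let rhofin' : (chain_var level q rho (time0 R) (time1 R) < +oo)%E.
Proof. by rewrite -Vcond_chain_var. Qed.

Let powRK M : 0 <= M -> (M `^ p^-1) `^ p = M.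
Proof. by move=> M0; rewrite -powRrM mulVf ?gt_eqF// powRr1. Qed.

Lemma integral_Drho_lt_pinfty :
  (\int[lambda]_tau `|Drho (proj U) rho tau|%:E < +oo)%E.
Proof.
(* Adding 1 makes [M] positive whatever the variation. *)
pose M := (P (time0 R) (time1 R) + 1) `^ p^-1.
have M0 : 0 < M by rewrite powR_gt0// ltr_wpDl// rvar_ge0.
have wM m : chain (time0 R) (time1 R) m -> chain_sum p w m <= M `^ p.
  move=> cm; rewrite /M powRK ?addr_ge0 ?rvar_ge0//.
  by apply: le_trans (chain_sum_rvar wfin' cm _) _ => //; rewrite lerDl.
have rhoQ m : chain (time0 R) (time1 R) m -> linked level m ->
    chain_sum q rho m <= Q (time0 R) (time1 R) by exact: chain_sum_rvar.
pose A : set T := tree_arc (proj U) (proj (time0 R)) `|` tree_arc (proj U) (proj (time1 R)).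
have mA : measurable A.
  by apply: measurableU; apply: measurable_tree_arc; exact: root_anc.
have lA : (lambda A < +oo)%E.
  have m s : measurable (tree_arc (proj U) (proj s) : set T).
    by apply: measurable_tree_arc; exact: root_anc.
  apply: (@le_lt_trans _ _ (lambda (tree_arc (proj U) (proj (time0 R))) +
      lambda (tree_arc (proj U) (proj (time1 R))))%E); first exact: measureU2.
  by rewrite !lambda_length.2 -EFinD ltry.
have offA tau : ~ A tau -> off_spines tau.
  by move=> nA; split=> h; apply: nA; [left|right]; exact/(arc_rootE minU).
pose B := ((2 * S)%:E * lambda A + (young_const p q * M * Q (time0 R) (time1 R) `^ q^-1)%:E)%E.
apply: (@le_lt_trans _ _ B); last first.
  rewrite /B; apply: lte_add_pinfty; last exact: ltry.
  by apply: lte_mul_pinfty => //; rewrite lee_fin mulr_ge0.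
(* The measurability of [Drho] is not assumed here: the integral is a supremum over simple functions
   [h] below the integrand, and each [h] is bounded uniformly, by [2 * S] on the arcs of [A] and by
   [excursion_integral] off them. *)
rewrite ge0_integralTE//; apply: ge_ereal_sup => _ [h /= hle <-].
rewrite -integralT_nnsfun -(setUv A) ge0_integral_setU//; last 4 first.
- exact: measurableC.
- by rewrite setUv; exact/measurable_EFinP/measurable_funP.
- by move=> x _; rewrite lee_fin.
- by rewrite disj_set2E setICr.
apply: leeD.
  rewrite -integral_cst//; apply: ge0_le_integral => //.
  - by move=> x _; rewrite lee_fin.
  - by apply: (@measurable_funS _ _ _ _ setT) => //; exact/measurable_EFinP/measurable_funP.
  - by move=> tau _; apply: le_trans (hle tau) _; rewrite lee_fin; exact: Drho_le.
rewrite integral_mkcond.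
apply: (excursion_integral minU lambda_length p1 q1 pq M0 (rvar_ge0 _ _ _ _ _) wM rhoQ).
- apply/(measurable_restrictT _ (measurableC mA)).
  by apply: (@measurable_funS _ _ _ _ setT) => //; exact/measurable_EFinP/measurable_funP.
- by move=> tau; rewrite erestrict_ge0// => x _; rewrite lee_fin.
- move=> tau; rewrite /patch; case: ifPn => [/set_mem/offA[n0 n1]|_]; last by rewrite lee_fin.
  apply: le_trans (hle tau) _; rewrite (DrhoE minU).
  by do 2 (case: asboolP => // _).
- move=> tau nex; rewrite /patch; case: ifPn => // /set_mem/offA off.
  by exfalso; apply: nex; split => //; [exact: time_ge0|exact: time_le1].
Qed.

Hypothesis mD : forall t, measurable_fun [set: T]
  (Drho (proj U) (restr_itv (time0 R) t rho) : T -> R).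
Local Notation D s t := (Drho (proj U) (restr_itv s t rho)).
Let J := tree_int (proj U) lambda rho (time0 R).
Let K := young_const p q * Q (time0 R) (time1 R) `^ q^-1 + 4 * S.

Let Q0 : 0 <= Q (time0 R) (time1 R). Proof. exact: rvar_ge0. Qed.
Let P0 : 0 <= P (time0 R) (time1 R). Proof. exact: rvar_ge0. Qed.
Let C0 : 0 <= young_const p q. Proof. exact: young_const_ge0. Qed.

Let K0 : 0 <= K.
Proof. by rewrite addr_ge0// mulr_ge0// powR_ge0. Qed.

Lemma Drho_split s t tau : time s <= time t ->
  D (time0 R) t tau - D (time0 R) s tau = D s t tau.
Proof.
move=> st; rewrite !(DrhoE minU).
have E u : restr_itv (time0 R) t rho u - restr_itv (time0 R) s rho u = restr_itv s t rho u.
  rewrite !restr_itvE; have := time_ge0 s.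
  rewrite {1}[time (time0 R)]/time /=.
  have [h1|h1] := ltP (time (time0 R)) (time u) => /=; last first.
    rewrite subr0 ifF//; apply/negbTE; rewrite negb_and -leNgt; apply/orP; left.
    exact: le_trans h1 (time_ge0 s).
  have [h2|h2] := leP (time u) (time s); last by rewrite subr0.
  by rewrite (le_trans h2 st) subrr.
by rewrite -!E; do 2 case: ifP => _; lra.
Qed.

Lemma measurable_D s t : time s <= time t -> measurable_fun setT (D s t : T -> R).
Proof.
move=> st; have -> : D s t = (D (time0 R) t : T -> R) \- D (time0 R) s.
  by apply/funext => tau; rewrite -(Drho_split _ st).
exact: measurable_funB.
Qed.

Lemma integrable_D t : lambda.-integrable setT (fun tau => (D (time0 R) t tau)%:E).
Proof.
have st : time (time0 R) <= time t by exact: time_ge0.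
have [c [stc cs ct]] := between_argmin w (time0 R) t.
pose M := (P (time0 R) (time1 R) + 1) `^ p^-1.
have M0 : 0 < M by rewrite powR_gt0// ltr_wpDl// rvar_ge0.
have wM m : chain (time0 R) t m -> chain_sum p w m <= M `^ p.
  move=> cm; rewrite /M powRK ?addr_ge0//.
  have := chain_sum_rvar wfin' (chainS (lexx _) (time_le1 t : time t <= time (time1 R)) cm).
  by move=> /(_ (fun _ _ => Logic.I)) /le_trans; apply; rewrite lerDl.
have rhoQ m : chain (time0 R) t m -> linked level m ->
    chain_sum q rho m <= Q (time0 R) (time1 R).
  by move=> cm; apply: chain_sum_rvar => //;
    exact: chainS (lexx _) (time_le1 t : time t <= time (time1 R)) cm.
exact: (integrable_increment minU lambda_length st stc cs ct p1 q1 pq M0 Q0 wM rhoQ rhoS (mD t)).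
Qed.

Lemma tree_int_increment s t : time s <= time t ->
  J t - J s = fine (\int[lambda]_tau (D s t tau)%:E).
Proof.
move=> st; rewrite /J /tree_int -RintegralB//; try exact: integrable_D.
by rewrite /Rintegral; congr fine; apply: eq_integral => tau _; rewrite Drho_split.
Qed.

(** The variation of [w] is taken on [[s, t]], that of [rho] on [[0, 1]] inside the constant [K], as
    [chain_var_le] requires. *)
Lemma tree_int_increment_le s t : time s <= time t ->
  `|J t - J s| `^ p <= K `^ p * P s t.
Proof.
move=> st; have [c [stc cs ct]] := between_argmin w s t.
have Pst0 : 0 <= P s t by exact: rvar_ge0.
(* [P s t] may vanish whereas [M] has to be positive, hence the slack [e], which then tends to 0. *)
suff main e : 0 < e -> `|J t - J s| `^ p <= K `^ p * (P s t + e).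
  apply/ler_addgt0Pl => e e0; apply: le_trans (main (e / (K `^ p + 1)) _) _.
    by rewrite divr_gt0// ltr_wpDl// powR_ge0.
  rewrite mulrDr addrC lerD2r mulrA mulrAC ler_piMl ?(ltW e0)//.
  by rewrite ler_pdivrMr ?mul1r ?lerDl// ltr_wpDl// powR_ge0.
move=> e0; pose M := (P s t + e) `^ p^-1.
have M0 : 0 < M by rewrite powR_gt0// ltr_wpDl.
have MpE : M `^ p = P s t + e by rewrite powRK// addr_ge0// ltW.
have wM m : chain s t m -> chain_sum p w m <= M `^ p.
  move=> cm; rewrite MpE; apply: le_trans (chain_sum_rvar wfin' cm _) _ => //.
  by rewrite lerDl ltW.
have rhoQ m : chain s t m -> linked level m -> chain_sum q rho m <= Q (time0 R) (time1 R).
  move=> cm; apply: chain_sum_rvar => //.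
  exact: chainS (time_ge0 s : time (time0 R) <= time s) (time_le1 t : time t <= time (time1 R)) cm.
have := integral_increment_le minU lambda_length st stc cs ct p1 q1 pq M0 Q0 wM rhoQ rhoS
  (measurable_D st).
rewrite -/K => h; rewrite -MpE -powRM ?K0 ?(ltW M0)//; apply: powR_le; rewrite ?(ltW p0)//.
rewrite tree_int_increment// -lee_fin; apply: le_trans h.
apply: le_trans (abs_fine_le _) _; apply: le_abse_integral => //.
by apply/measurable_EFinP; exact: measurable_D.
Qed.

(** Here the roles are exchanged: [M] controls [w] globally, and the variation of [rho] is localized
    to [[s, t]]. *)
Lemma tree_int_increment_level M s t : 0 < M -> P (time0 R) (time1 R) <= M `^ p ->
  time s <= time t -> w s = w t ->
  `|J t - J s| `^ q <= ((young_const p q + 1) * M) `^ q * Q s t.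
Proof.
move=> M0 PM st wst; have [c [stc cs ct]] := between_argmin w s t.
have wM m : chain s t m -> chain_sum p w m <= M `^ p.
  move=> cm; apply: le_trans PM; apply: chain_sum_rvar => //.
  exact: chainS (time_ge0 s : time (time0 R) <= time s) (time_le1 t : time t <= time (time1 R)) cm.
have rhoQ m : chain s t m -> linked level m -> chain_sum q rho m <= Q s t.
  by move=> cm; exact: chain_sum_rvar.
have Qst0 : 0 <= Q s t by exact: rvar_ge0.
have := integral_increment_level minU lambda_length st stc cs ct p1 q1 pq M0 Qst0 wM rhoQ rhoS
  (measurable_D st) wst.
set X := (\int[lambda]_tau _)%E => h.
have hX : `|J t - J s| <= (young_const p q + 1) * M * Q s t `^ q^-1.
  rewrite tree_int_increment// -/X -lee_fin; apply: le_trans h.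
  exact: abs_fine_le.
have C1M : 0 <= (young_const p q + 1) * M by rewrite mulr_ge0 ?addr_ge0// ltW.
apply: le_trans (powR_le (ltW q0) (normr_ge0 _) hX) _.
rewrite powRM ?powR_ge0// -powRrM mulVf ?gt_eqF// powRr1//.
Qed.

End tree_integral_bounds.

(** * The Banach space *)

Section minkowski.
Local Open Scope convex_scope.

(* By convexity of [t ^ q], writing [(x + y) / (a + b)] as the convex combination of
   [x / a] and [y / b] with weights [a / (a + b)] and [b / (a + b)]. *)
Lemma minkowski_sum (R : realType) (T : Type) (l : seq T) (x y : T -> R) (q a b : R) :
  1 <= q -> 0 < a -> 0 < b -> (forall i, 0 <= x i) -> (forall i, 0 <= y i) ->
  \sum_(i <- l) x i `^ q <= a `^ q -> \sum_(i <- l) y i `^ q <= b `^ q ->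
  \sum_(i <- l) (x i + y i) `^ q <= (a + b) `^ q.
Proof.
move=> q1 a0 b0 x0 y0 xa yb; have ab0 : 0 < a + b by exact: addr_gt0.
have q0 : 0 <= q by rewrite (le_trans _ q1).
pose k := a / (a + b); have k0 : 0 <= k by rewrite divr_ge0 ?ltW.
have k1 : k <= 1 by rewrite ler_pdivrMr// mul1r lerDl ltW.
have cvx u v : 0 <= u -> 0 <= v ->
    (k * u + (1 - k) * v) `^ q <= k * u `^ q + (1 - k) * v `^ q.
  move=> u0 v0; have := @convex_powR R q q1 (Itv01 k0 k1) u v.
  by rewrite !inE/= !in_itv/= u0 v0 => /(_ isT isT).
have term i : (x i + y i) `^ q <=
    (a + b) `^ q * (k * (x i `^ q / a `^ q) + (1 - k) * (y i `^ q / b `^ q)).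
  have -> : x i + y i = (a + b) * (k * (x i / a) + (1 - k) * (y i / b)).
    by rewrite /k; field; rewrite ?gt_eqF.
  have xa0 : 0 <= x i / a by rewrite divr_ge0// ltW.
  have yb0 : 0 <= y i / b by rewrite divr_ge0// ltW.
  rewrite powRM ?(ltW ab0)//; last by rewrite addr_ge0// mulr_ge0// subr_ge0.
  rewrite ler_wpM2l ?powR_ge0//.
  have E z d : 0 <= z -> 0 < d -> z `^ q / d `^ q = (z / d) `^ q.
    move=> z0 d0; rewrite powRM ?invr_ge0 ?(ltW d0)//; congr (_ * _).
    by rewrite -powRN -powR_inv1 ?(ltW d0)// -powRrM mulN1r.
  by rewrite !E//; exact: cvx.
apply: le_trans (ler_sum _ (fun i _ => term i)) _.
rewrite -mulr_sumr big_split/= -!mulr_sumr -!mulr_suml.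
rewrite -[leRHS]mulr1 ler_wpM2l ?powR_ge0//.
rewrite [leRHS](_ : _ = k * 1 + (1 - k) * 1); last by ring.
by apply: lerD; rewrite ler_wpM2l ?subr_ge0// ler_pdivrMr ?powR_gt0// mul1r.
Qed.

End minkowski.

Section cond_variation_space.
Context {R : realType}.
Local Notation I := (unit_itv R).
Variables (q : R) (w : I -> R).
Hypothesis q1 : 1 <= q.
Implicit Types f g : I -> R.
Local Notation level := (fun x y : I => w x = w y).

Let q0 : 0 < q. Proof. exact: lt_le_trans q1. Qed.

Definition fine_seminorm f : R := fine (Vcond q f w) `^ q^-1.

Definition sup_norm f : R := fine (ereal_sup [set `|f t|%:E | t in [set: I]]).

Lemma Vcond_ge0 f : (0 <= Vcond q f w)%E.
Proof. by rewrite Vcond_chain_var chain_var_ge0. Qed.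

Lemma fine_seminorm_ge0 f : 0 <= fine_seminorm f. Proof. exact: powR_ge0. Qed.

Lemma Vcond_poweR f : (Vcond q f w < +oo)%E ->
  (Vcond q f w `^ q^-1 = (fine_seminorm f)%:E)%E.
Proof.
move=> ff; rewrite /fine_seminorm -poweR_EFin fineK//.
by rewrite ge0_fin_numE// Vcond_ge0.
Qed.

(** Reduces finiteness and the bound on the seminorm to one chain at a time, where finite
    inequalities apply. *)
Lemma seminorm_leP f (a : R) : 0 <= a ->
  (forall l, chain (time0 R) (time1 R) l -> linked level l -> chain_sum q f l <= a `^ q) <->
  (Vcond q f w < +oo)%E /\ fine_seminorm f <= a.
Proof.
move=> a0; rewrite /fine_seminorm Vcond_chain_var; split=> [h|[fin fa] l cl Pl].
  have le : (chain_var level q f (time0 R) (time1 R) <= (a `^ q)%:E)%E.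
    by apply: ge_ereal_sup => _ [l [cl Pl] <-]; rewrite lee_fin h.
  have fin := le_lt_trans le (ltry _); split => //.
  rewrite -[leRHS](_ : (a `^ q) `^ q^-1 = a); last first.
    by rewrite -powRrM divff ?gt_eqF// powRr1.
  apply: powR_le; rewrite ?invr_ge0 ?(ltW q0)//; first exact: rvar_ge0.
  by rewrite -lee_fin rvarE.
apply: le_trans (chain_sum_rvar fin cl Pl) _; rewrite /rvar.
have := powR_le (ltW q0) (powR_ge0 _ _) fa.
by rewrite -powRrM mulVf ?gt_eqF// powRr1// fine_ge0 ?chain_var_ge0.
Qed.

Local Opaque fine_seminorm.

Lemma seminormD f g : (Vcond q f w < +oo)%E -> (Vcond q g w < +oo)%E ->
  (Vcond q (f + g)%R w < +oo)%E /\ fine_seminorm (f + g) <= fine_seminorm f + fine_seminorm g.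
Proof.
move=> ff fg.
(* [minkowski_sum] needs positive bounds, whereas seminorms may vanish; [e] is removed at the
   end. *)
have main e : 0 < e -> (Vcond q (f + g)%R w < +oo)%E /\
    fine_seminorm (f + g) <= (fine_seminorm f + e) + (fine_seminorm g + e).
  move=> e0; have nf := fine_seminorm_ge0 f; have ng := fine_seminorm_ge0 g.
  have af : 0 < fine_seminorm f + e := ltr_wpDl nf e0.
  have ag : 0 < fine_seminorm g + e := ltr_wpDl ng e0.
  apply: ((seminorm_leP (f + g) (addr_ge0 (ltW af) (ltW ag))).1 _) => l cl Pl.
  have lee (x : R) : x <= x + e by rewrite lerDl; exact: ltW.
  have sf := (seminorm_leP f (ltW af)).2 (conj ff (lee _)) l cl Pl.
  have sg := (seminorm_leP g (ltW ag)).2 (conj fg (lee _)) l cl Pl.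
  apply: le_trans (minkowski_sum q1 af ag _ _ sf sg) => //.
  apply: ler_sum => p _; apply: powR_le; rewrite ?(ltW q0)//.
  rewrite [X in `|X|](_ : _ = (f p.2 - f p.1) + (g p.2 - g p.1)); first exact: ler_normD.
  have fgE t : (f + g) t = f t + g t by [].
  by rewrite !fgE opprD addrACA.
split; first by have [] := main 1 ltr01.
apply/ler_addgt0Pr => e e0; have [_] := main (e / 2) (divr_gt0 e0 (ltr0Sn _ _)).
by rewrite addrACA -splitr.
Qed.

Lemma seminormZ_le (c : R) f : (Vcond q f w < +oo)%E ->
  (Vcond q (c *: f)%R w < +oo)%E /\ fine_seminorm (c *: f) <= `|c| * fine_seminorm f.
Proof.
move=> ff; have c0 : 0 <= `|c| * fine_seminorm f by rewrite mulr_ge0// fine_seminorm_ge0.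
apply: ((seminorm_leP (c *: f) c0).1 _) => l cl Pl.
have sf := (seminorm_leP f (fine_seminorm_ge0 f)).2 (conj ff (lexx _)) l cl Pl.
rewrite powRM ?fine_seminorm_ge0//; apply: le_trans (ler_wpM2l (powR_ge0 _ _) sf).
rewrite /chain_sum mulr_sumr; apply: ler_sum => p _.
rewrite -powRM// -normrM mulrBr; exact: lexx.
Qed.

Lemma sup_normP f : bounded_fun f ->
  [/\ ereal_sup [set `|f t|%:E | t in [set: I]] = (sup_norm f)%:E,
      forall t, `|f t| <= sup_norm f &
      forall S, (forall t, `|f t| <= S) -> sup_norm f <= S].
Proof.
move=> /bounded_fun_bound[S fS].
have leS S' : (forall t, `|f t| <= S') ->
    (ereal_sup [set `|f t|%:E | t in [set: I]] <= S'%:E)%E.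
  by move=> fS'; apply: ge_ereal_sup => _ [t _ <-]; rewrite lee_fin.
have ub t : (`|f t|%:E <= ereal_sup [set `|f t|%:E | t in [set: I]])%E.
  by apply: ereal_sup_ubound; exists t.
have E : ereal_sup [set `|f t|%:E | t in [set: I]] = (sup_norm f)%:E.
  rewrite /sup_norm fineK// ge0_fin_numE; first exact: le_lt_trans (leS _ fS) (ltry _).
  by apply: le_trans (ub (time0 R)); rewrite lee_fin.
split => //; first by move=> t; rewrite -lee_fin -E.
by move=> S' fS'; rewrite -lee_fin -E; exact: leS.
Qed.

Local Opaque sup_norm.

Definition Bnorm_fine f : R := fine_seminorm f + sup_norm f.

Lemma BnormE f : Bspace q w f -> Bnorm q w f = (Bnorm_fine f)%:E.
Proof.
by move=> [bf ff]; rewrite /Bnorm Vcond_poweR// EFinD; have [-> _ _] := sup_normP bf.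
Qed.

Lemma BspaceD f g : Bspace q w f -> Bspace q w g ->
  Bspace q w (f + g) /\ Bnorm_fine (f + g) <= Bnorm_fine f + Bnorm_fine g.
Proof.
move=> [bf ff] [bg fg]; have [fin ns] := seminormD ff fg.
have [_ fub _] := sup_normP bf; have [_ gub _] := sup_normP bg.
have ub t : `|(f + g) t| <= sup_norm f + sup_norm g.
  by apply: le_trans (ler_normD _ _) _; apply: lerD.
have bfg : bounded_fun (f + g) by apply/bounded_fun_bound; exists (sup_norm f + sup_norm g).
split => //; rewrite /Bnorm_fine addrACA; apply: lerD => //.
by have [_ _] := sup_normP bfg; apply.
Qed.

Lemma BspaceZ (c : R) f : Bspace q w f ->
  Bspace q w (c *: f) /\ Bnorm_fine (c *: f) <= `|c| * Bnorm_fine f.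
Proof.
move=> [bf ff]; have [fin ns] := seminormZ_le c ff.
have [_ fub _] := sup_normP bf.
have ub t : `|(c *: f) t| <= `|c| * sup_norm f.
  by rewrite [X in `|X|](_ : _ = c * f t)// normrM ler_wpM2l.
have bcf : bounded_fun (c *: f) by apply/bounded_fun_bound; exists (`|c| * sup_norm f).
split => //; rewrite /Bnorm_fine mulrDr; apply: lerD => //.
by have [_ _] := sup_normP bcf; apply.
Qed.

Lemma Bspace0 : Bspace q w 0.
Proof.
split; first by apply/bounded_fun_bound; exists 0 => t; rewrite normr0.
apply: ((seminorm_leP 0 (lexx 0)).1 _).1 => l _ _.
rewrite /chain_sum big1 ?powR_ge0// => p _.
by rewrite subrr normr0 powR0 ?gt_eqF.
Qed.

(** The dummy [let] makes the predicate depend on [q1], on which its closure under linear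
    combinations relies. *)
Definition Bpred : {pred (I -> R)} := fun f => let _ := q1 in `[< Bspace q w f >].

Lemma BpredP f : reflect (Bspace q w f) (f \in Bpred).
Proof. exact: asboolP. Qed.

Lemma Bpred_submod_closed : submod_closed Bpred.
Proof.
split; first exact/BpredP/Bspace0.
move=> a f g /BpredP hf /BpredP hg; apply/BpredP.
by apply: (BspaceD (BspaceZ a hf).1 hg).1.
Qed.

HB.instance Definition _ := GRing.isSubmodClosed.Build R (I -> R) Bpred
  (GRing.submod_closed_semi Bpred_submod_closed).

Record Btype := MkB { Bval :> I -> R ; Bval_in : Bval \in Bpred }.

HB.instance Definition _ := [isSub for Bval].
HB.instance Definition _ := [Choice of Btype by <:].
HB.instance Definition _ := [SubChoice_isSubLmodule of Btype by <:].

Lemma BvalP (b : Btype) : Bspace q w b. Proof. exact/BpredP/Bval_in. Qed.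

Let nrm (b : Btype) : R := Bnorm_fine b.

Let nrmD (b c : Btype) : nrm (b + c) <= nrm b + nrm c.
Proof. exact: (BspaceD (BvalP b) (BvalP c)).2. Qed.

Let nrmZ (l : R) (b : Btype) : nrm (l *: b) = `|l| * nrm b.
Proof.
have le l' (c : Btype) : nrm (l' *: c) <= `|l'| * nrm c.
  exact: (BspaceZ l' (BvalP c)).2.
apply/eqP; rewrite eq_le le/=; have [->|l0] := eqVneq l 0.
  rewrite normr0 mul0r addr_ge0 ?fine_seminorm_ge0//.
  have [_ h _] := sup_normP (BvalP (0 *: b)).1; exact: le_trans (h (time0 R)).
(* The reverse inequality is the direct one applied to [l^-1] and [l *: b]. *)
rewrite -ler_pdivlMl ?normr_gt0// -normfV; apply: le_trans (le l^-1 (l *: b)).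
by rewrite scalerA mulVf// scale1r.
Qed.

Let nrm_sup (b : Btype) t : `|(b : I -> R) t| <= nrm b.
Proof.
have [_ h _] := sup_normP (BvalP b).1.
by apply: le_trans (h t) _; rewrite lerDr fine_seminorm_ge0.
Qed.

Let nrm0 (b : Btype) : nrm b = 0 -> b = 0.
Proof.
move=> b0; apply: val_inj; apply/funext => t; apply/eqP.
by rewrite -normr_eq0 eq_le normr_ge0 andbT; have := nrm_sup b t; rewrite b0.
Qed.

HB.instance Definition _ := Lmodule_isNormed.Build R Btype nrmD nrmZ nrm0.


Lemma Bnorm_normE (b : Btype) : `|b| = Bnorm_fine b.
Proof. by []. Qed.

Lemma Btype_sup (b : Btype) t : `|(b : I -> R) t| <= `|b|.
Proof. exact: nrm_sup. Qed.

Lemma Btype_chain (b : Btype) l : chain (time0 R) (time1 R) l -> linked level l ->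
  chain_sum q b l <= `|b| `^ q.
Proof.
move=> cl Pl; apply: ((seminorm_leP b (normr_ge0 b)).2 _ l cl Pl).
split; first exact: (BvalP b).2.
rewrite Bnorm_normE /Bnorm_fine lerDl.
by have [_ h _] := sup_normP (BvalP b).1; exact: le_trans (h (time0 R)).
Qed.

(** The norm dominates every evaluation, so the filter converges pointwise to some [f]. The norm
    bound passes to [f] because a chain involves finitely many times, at all of which one element of
    the filter can be close to [f]. *)
Lemma Btype_complete (F : set_system Btype) : ProperFilter F -> cauchy F -> cvg F.
Proof.
move=> PF cF.
have ball_near (e : R) : 0 < e -> exists x : Btype, F [set b | `|x - b| < e].
  by move=> e0; have /cauchyP/(_ e e0)[x hx] := cF; exists x; move: hx; rewrite -ball_normE.
have [f fP] : exists f : I -> R, forall t (e : R), 0 < e ->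
    F [set b : Btype | `|(b : I -> R) t - f t| < e].
  suff /choice[f fP] : forall t, exists y : R, forall e : R, 0 < e ->
      F [set b : Btype | `|(b : I -> R) t - y| < e] by exists f.
  move=> t; pose ev (b : Btype) : R := (b : I -> R) t.
  have cev : cauchy (ev @ F).
    apply/cauchyP => e e0; have [x hx] := ball_near e e0; exists (ev x).
    suff : F (ev @^-1` ball (ev x) e) by [].
    apply: filterS hx => b /= h; rewrite -ball_normE /=.
    exact: le_lt_trans (Btype_sup (x - b) t) h.
  move/cauchy_cvgP : cev => /cvg_ex[y /cvgrPdist_lt hy].
  exists y => e e0; have := hy e e0; apply: filterS => b /=.
  by rewrite distrC.
have near_l (l : seq I) (x : Btype) (d e : R) : 0 < d -> F [set b | `|x - b| < e] ->
    exists b : Btype, `|x - b| < e /\ forall t, t \in l -> `|(b : I -> R) t - f t| < d.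
  move=> d0 Fx.
  suff : F [set b : Btype | forall t, t \in l -> `|(b : I -> R) t - f t| < d].
    by move=> Fl; have [b [hx hl]] := filter_ex (filterI Fx Fl); exists b.
  elim: l => [|t l ih]; first exact: filterS (@filterT _ F _).
  have Ft := fP t d d0; apply: filterS (filterI Ft ih) => b [h1 h2] u.
  by rewrite inE => /orP[/eqP ->//|/h2].
have dist_le (x : Btype) (e : R) : 0 < e -> F [set b | `|x - b| < e] ->
    Bspace q w (f - x) /\ Bnorm_fine (f - x) <= e + e.
  move=> e0 Fx.
  have ub t : `|(f - (x : I -> R)) t| <= e.
    apply/ler_addgt0Pr => d d0; have [b [h1 h2]] := near_l [:: t] x d e d0 Fx.
    have h3 := h2 t (mem_head _ _); have h4 := Btype_sup (x - b) t.
    have -> : (f - (x : I -> R)) t = - ((b : I -> R) t - f t) - (((x - b) : Btype) : I -> R) t.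
      have -> : (((x - b) : Btype) : I -> R) t = (x : I -> R) t - (b : I -> R) t by [].
      have -> : (f - (x : I -> R)) t = f t - (x : I -> R) t by [].
      by ring.
    apply: le_trans (ler_normB _ _) _; rewrite normrN addrC.
    by apply: lerD; apply: ltW => //; exact: le_lt_trans h4 h1.
  have bfx : bounded_fun (f - (x : I -> R)) by apply/bounded_fun_bound; exists e.
  have main (e' : R) : 0 < e' -> (Vcond q (f - (x : I -> R))%R w < +oo)%E /\
      fine_seminorm (f - (x : I -> R)) <= e + e'.
    move=> e'0.
    apply: ((seminorm_leP (f - (x : I -> R)) (addr_ge0 (ltW e0) (ltW e'0))).1 _) => l cl Pl.
    (* Each of the [size l] error terms is at most [(e' / n) ^ q], and [size l <= n <= n ^ q], so
       they add up to at most [e' ^ q]. *)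
    pose n : R := (size l).+1%:R; have n0 : 0 < n by rewrite ltr0n.
    pose d := e' / (2 * n); have d0 : 0 < d by rewrite divr_gt0// mulr_gt0.
    have [b [h1 h2]] := near_l ([seq p.1 | p <- l] ++ [seq p.2 | p <- l]) x d e d0 Fx.
    have sb : chain_sum q (x - b : Btype) l <= e `^ q.
      apply: le_trans (Btype_chain (x - b) cl Pl) _.
      by apply: powR_le; rewrite ?(ltW q0)// ltW.
    pose y (p : I * I) := if p \in l then
      `|((b : I -> R) p.2 - f p.2) - ((b : I -> R) p.1 - f p.1)| else 0.
    have sy : \sum_(p <- l) y p `^ q <= e' `^ q.
      have term p : p \in l -> y p `^ q <= (e' / n) `^ q.
        move=> pl; rewrite /y pl; apply: powR_le; rewrite ?(ltW q0)//.
        apply: le_trans (ler_normB _ _) _.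
        have -> : e' / n = d + d by rewrite /d; field; rewrite gt_eqF.
        by apply: lerD; apply/ltW/h2; rewrite mem_cat map_f ?orbT.
      rewrite big_seq; apply: le_trans (ler_sum _ term) _.
      rewrite -big_seq big_const_seq count_predT iter_addr_0 -[_ *+ _]mulr_natl.
      rewrite powRM ?(ltW e'0) ?invr_ge0 ?(ltW n0)// mulrCA ler_piMr ?powR_ge0//.
      have -> : n^-1 `^ q = (n `^ q)^-1.
        by rewrite -powRN -(powR_inv1 (ltW n0)) -powRrM mulN1r.
      rewrite ler_pdivrMr ?powR_gt0// mul1r.
      apply: (@le_trans _ _ n); first by rewrite ler_nat.
      by rewrite -[leLHS](powRr1 (ltW n0)) ler_powR// ler1n.
    have y0 p : 0 <= y p by rewrite /y; case: ifP.
    apply: le_trans (minkowski_sum q1 e0 e'0 _ y0 sb sy) => //.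
    rewrite /chain_sum !big_seq; apply: ler_sum => p pl; rewrite /y pl.
    apply: powR_le; rewrite ?(ltW q0)//.
    have fxE u : (f - (x : I -> R)) u = f u - (x : I -> R) u by [].
    have xbE u : ((x - b : Btype) : I -> R) u = (x : I -> R) u - (b : I -> R) u by [].
    rewrite [X in `|X|](_ : _ = - ((((x - b : Btype) : I -> R) p.2 -
      ((x - b : Btype) : I -> R) p.1) +
      (((b : I -> R) p.2 - f p.2) - ((b : I -> R) p.1 - f p.1)))).
      by rewrite normrN; exact: ler_normD.
    by rewrite !fxE !xbE; ring.
  split; first by split => //; have [] := main 1 ltr01.
  rewrite /Bnorm_fine; apply: lerD; last by have [_ _] := sup_normP bfx; apply.
  by apply/ler_addgt0Pr => d d0; have [] := main d d0.
have [x Fx] := ball_near 1 ltr01.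
have Bf : Bspace q w f.
  have [Bfx _] := dist_le x 1 ltr01 Fx.
  by have := (BspaceD Bfx (BvalP x)).1; rewrite subrK.
apply/cvg_ex; exists (MkB (introT (BpredP f) Bf)).
apply/cvgrPdist_lt => e e0.
have e40 : 0 < e / 4 by rewrite divr_gt0.
have [x' Fx'] := ball_near (e / 4) e40.
have [_ fx'] := dist_le x' (e / 4) e40 Fx'.
move: Fx'; apply: filterS => b /= xb.
set g := MkB _.
have gx : `|g - x'| <= e / 4 + e / 4 by exact: fx'.
have -> : g - b = (g - x') + (x' - b) by rewrite addrA subrK.
apply: le_lt_trans (ler_normD _ _) _.
apply: lt_le_trans (_ : e / 4 + e / 4 + e / 4 <= e); last by lra.
by rewrite ler_ltD.
Qed.

HB.instance Definition _ := Uniform_isComplete.Build Btype Btype_complete.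

End cond_variation_space.

Lemma Bspace_Banach (R : realType) (q : R) (w : unit_itv R -> R) : 1 <= q ->
  is_Banach_space (Bspace q w) (Bnorm q w).
Proof.
move=> q1; exists (Btype w q1 : completeNormedModType R).
exists (\val : {linear Btype w q1 -> (unit_itv R -> R)}); split.
- exact: val_inj.
- apply/seteqP; split=> [_ [b _ <-]|f hf]; first exact: BvalP.
  by exists (MkB (introT (BpredP w q1 f) hf)).
- by move=> b; rewrite (BnormE (BvalP b)).
Qed.

(** * From variation indices to exponents *)

Section exponents.
Context {R : realType}.

(** The first case is an infinite infimum. In the second the infimum may not be attained, so its
    inverse is only approached by inverses of exponents. *)
Lemma ereal_inf_exponent (A : set R) : (forall p, A p -> 1 <= p) ->
  ((ereal_inf [set p%:E | p in A])^-1 = 0)%E \/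
  exists2 a : R, (ereal_inf [set p%:E | p in A])^-1%E = a%:E &
    a <= 1 /\ forall e, 0 < e -> exists2 p, A p & a - e < p^-1.
Proof.
move=> A1; set i := ereal_inf _.
have i1 : (1 <= i)%E by apply: le_ereal_inf_tmp => _ [p /A1 p1 <-]; rewrite lee_fin.
case E : i i1 => [r| |]// i1; last by left.
right; have r1 : 1 <= r by rewrite -lee_fin.
have r0 : 0 < r by exact: lt_le_trans r1.
exists r^-1; first by rewrite inver gt_eqF.
split=> [|e e0]; first by rewrite invf_le1.
have ifin : i \is a fin_num by rewrite E.
have [_ [p Ap <-]] := lb_ereal_inf_adherent e0 ifin.
rewrite -/i E -EFinD lte_fin => pre; exists p => //.
have p1 := A1 _ Ap; have p0 : 0 < p by exact: lt_le_trans p1.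
rewrite ltrBlDr -ltrBlDl.
have [pr|rp] := leP p r.
  apply: le_lt_trans e0; rewrite subr_le0 lef_pV2//.
have -> : r^-1 - p^-1 = (p - r) / (p * r) by field; rewrite !gt_eqF.
rewrite ltr_pdivrMr ?mulr_gt0//; apply: lt_le_trans (_ : e <= _); first by lra.
by rewrite ler_peMr ?(ltW e0)// mulr_ege1.
Qed.

Lemma conjugate_exponents (A B : set R) :
  (forall p, A p -> 1 <= p) -> (forall p, B p -> 1 <= p) ->
  (1 < (ereal_inf [set p%:E | p in A])^-1 + (ereal_inf [set p%:E | p in B])^-1)%E ->
  exists p q, [/\ A p, B q & 1 < p^-1 + q^-1].
Proof.
move=> A1 B1.
have [->|[a -> [a1 Aa]]] := ereal_inf_exponent A1.
  rewrite add0e; have [->|[b -> [b1 _]]] := ereal_inf_exponent B1.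
    by rewrite lte_fin ltr10.
  by rewrite lte_fin ltNge b1.
have [->|[b -> [b1 Bb]]] := ereal_inf_exponent B1.
  by rewrite adde0 lte_fin ltNge a1.
(* The strict inequality leaves room for a loss of half the excess in each of the two inverses. *)
rewrite -EFinD lte_fin => ab; have e0 : 0 < (a + b - 1) / 2 by lra.
have [p Ap hp] := Aa _ e0; have [q Bq hq] := Bb _ e0.
by exists p, q; split => //; lra.
Qed.

End exponents.

Lemma poweR_le (R : realType) (r : R) (x y : \bar R) : 0 <= r -> (0 <= x)%E -> (x <= y)%E ->
  (x `^ r <= y `^ r)%E.
Proof.
move=> r0 x0 xy; apply: gt0_ler_poweR => //; rewrite in_itv/= leey andbT//.
exact: le_trans xy.
Qed.

Theorem theorem4p7 (R : realType) :
  (forall (w : continuousType (unit_itv R) R) (U : unit_itv R)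
      (lambda : {measure set (borel_tree w) -> \bar R})
      (rho : unit_itv R -> R),
    (exists s t, w s <> w t) ->
    is_min_time w U ->
    is_length_measure (tree_proj w U) lambda ->
    bounded_fun rho ->
    (1 < (var_index w)^-1 + (cond_var_index rho w)^-1)%E ->
    (\int[lambda]_tau `|Drho (tree_proj w U) rho tau|%:E < +oo)%E) /\
  (forall p q : R, 1 <= p -> 1 <= q -> 1 < p^-1 + q^-1 ->
    exists C : R,
    forall w : continuousType (unit_itv R) R,
    (exists s t, w s <> w t) ->
    (Vp p w < +oo)%E ->
    is_Banach_space (Bspace q w) (Bnorm q w) /\
    forall (U : unit_itv R)
      (lambda : {measure set (borel_tree w) -> \bar R})
      (rho : unit_itv R -> R),
    is_min_time w U ->
    is_length_measure (tree_proj w U) lambda ->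
    Bspace q w rho ->
    (forall t, measurable_fun [set: borel_tree w]
       (Drho (tree_proj w U) (restr_itv (time0 R) t rho) : borel_tree w -> R)) ->
    let J := tree_int (tree_proj w U) lambda rho (time0 R) in
    [/\ forall t, lambda.-integrable [set: borel_tree w]
          (fun tau => (Drho (tree_proj w U) (restr_itv (time0 R) t rho) tau)%:E),
        (Vcond q J w `^ q^-1 <= C%:E * Vp p w `^ p^-1 * Vcond q rho w `^ q^-1)%E &
        (Bnorm q w J + Vp p J `^ p^-1 <= C%:E * Vp p w `^ p^-1 * Bnorm q w rho)%E]).
Proof.
split.
  move=> w U lambda rho _ minU lambda_length /bounded_fun_bound[S rhoS] pq.
  have A1 p : 1 <= p /\ (Vp p w < +oo)%E -> 1 <= p by case.
  have B1 q : 1 <= q /\ (Vcond q rho w < +oo)%E -> 1 <= q by case.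
  have [p [q [[p1 wfin] [q1 rhofin] pq']]] := conjugate_exponents A1 B1 pq.
  exact: (integral_Drho_lt_pinfty minU lambda_length p1 q1 pq' rhoS wfin rhofin).
move=> p q p1 q1 pq; have p0 : 0 < p by exact: lt_le_trans p1.
have q0 : 0 < q by exact: lt_le_trans q1.
have [c cE] : exists c, c = young_const p q by eexists.
have c0 : 0 <= c by rewrite cE; exact: young_const_ge0.
(* With [X = Q ^ (1/q)], the seminorm contributes [(c + 1) X], and the supremum and the
   [p]-variation [c X + 4 S] each: in total [(3 c + 1) X + 8 S], up to the factor [M]. *)
exists (3 * c + 9) => w [s0 [t0 ne]] wfin; split; first exact: Bspace_Banach.
move=> U lambda rho minU lambda_length /[dup] Brho [brho rhofin] mD J.
have [supE rhoS _] := sup_normP brho; move: (sup_norm rho) supE rhoS => S supE rhoS.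
have S0 : 0 <= S by exact: le_trans (rhoS U).
have wfin' := wfin; rewrite Vp_chain_var in wfin'.
have rhofin' := rhofin; rewrite Vcond_chain_var in rhofin'.
have [P PE] : exists P, P = rvar (fun _ _ => True) p w (time0 R) (time1 R) by eexists.
have [Q QE] : exists Q, Q = rvar (fun x y => w x = w y) q rho (time0 R) (time1 R) by eexists.
have VpE : Vp p w = P%:E by rewrite Vp_chain_var PE rvarE.
have VqE : Vcond q rho w = Q%:E by rewrite Vcond_chain_var QE rvarE.
have Q0 : 0 <= Q by rewrite QE; exact: rvar_ge0.
(* The path is not constant, so two times with different values already give a positive
   variation. *)
have P0 : 0 < P.
  wlog st : s0 t0 ne / time s0 <= time t0 => [wl|].
    by have [/wl|/ltW/wl] := leP (time s0) (time t0); apply => // /esym.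
  rewrite PE; have := @chain_sum_rvar _ _ _ _ wfin' (time0 R) (time1 R) [:: (s0, t0)].
  rewrite /= st (time_le1 t0 : time t0 <= time (time1 R))
    (time_ge0 s0 : time (time0 R) <= time s0) => /(_ isT (fun _ _ => Logic.I)).
  apply: lt_le_trans; rewrite /chain_sum big_seq1 powR_gt0// normr_gt0 subr_eq0.
  by apply/eqP => /esym.
have [M ME] : exists M, M = P `^ p^-1 by eexists.
have M0 : 0 < M by rewrite ME powR_gt0.
have MpE : M `^ p = P by rewrite ME -powRrM mulVf ?gt_eqF// powRr1// ltW.
have [K KE] : exists K, K = c * Q `^ q^-1 + 4 * S by eexists.
have K0 : 0 <= K by rewrite KE addr_ge0// mulr_ge0// powR_ge0.
have Jinc s t : time s <= time t ->
    `|J t - J s| `^ p <= K `^ p * rvar (fun _ _ => True) p w s t.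
  rewrite KE cE QE; exact: (tree_int_increment_le minU lambda_length p1 q1 pq rhoS wfin rhofin mD).
have Jlevel s t : time s <= time t -> w s = w t ->
    `|J t - J s| `^ q <= ((c + 1) * M) `^ q * rvar (fun x y => w x = w y) q rho s t.
  rewrite cE; apply: (tree_int_increment_level minU lambda_length p1 q1 pq rhoS wfin rhofin mD M0).
  by rewrite MpE PE.
have VJ : (Vp p J `^ p^-1 <= (K * M)%:E)%E.
  have h : (Vp p J <= (K `^ p * P)%:E)%E.
    rewrite PE Vp_chain_var; apply: chain_var_le => //; first exact: powR_ge0.
    by move=> s t st _; exact: Jinc.
  apply: le_trans (poweR_le _ _ h) _; rewrite ?invr_ge0 ?(ltW p0)//.
    by rewrite Vp_chain_var chain_var_ge0.
  by rewrite poweR_EFin -MpE -powRM ?(ltW M0)// -powRrM divff ?gt_eqF// powRr1// mulr_ge0// ltW.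
have VqJ : (Vcond q J w `^ q^-1 <= ((c + 1) * M * Q `^ q^-1)%:E)%E.
  have h : (Vcond q J w <= (((c + 1) * M) `^ q * Q)%:E)%E.
    by rewrite QE Vcond_chain_var; apply: chain_var_le => //; exact: powR_ge0.
  have cM : 0 <= (c + 1) * M by rewrite mulr_ge0 ?addr_ge0// ltW.
  apply: le_trans (poweR_le _ _ h) _; rewrite ?invr_ge0 ?(ltW q0)//; first exact: Vcond_ge0.
  by rewrite poweR_EFin powRM ?powR_ge0// -powRrM divff ?gt_eqF// powRr1.
(* Since [J] starts at 0, its supremum is bounded by its increments from the time 0. *)
have J0 : J (time0 R) = 0.
  rewrite /J /tree_int /Rintegral (eq_integral (cst 0%E)) ?integral0// => tau _.
  have E u : restr_itv (time0 R) (time0 R) rho u = 0.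
    rewrite restr_itvE; case: ifP => // /andP[h1 h2].
    by have := lt_le_trans h1 h2; rewrite ltxx.
  by rewrite (DrhoE minU) !E !if_same subrr.
have supJ : (ereal_sup [set `|J t|%:E | t in [set: unit_itv R]] <= (K * M)%:E)%E.
  apply: ge_ereal_sup => _ [t _ <-]; rewrite lee_fin.
  have h := Jinc (time0 R) t (time_ge0 t); rewrite J0 subr0 in h.
  have -> : K * M = (K `^ p * P) `^ p^-1.
    by rewrite -MpE -powRM ?(ltW M0)// -powRrM divff ?gt_eqF// powRr1// mulr_ge0// ltW.
  apply: powR_leV => //; apply: le_trans h _; rewrite ler_wpM2l ?powR_ge0//.
  by rewrite PE; apply: rvarS => //; exact: time_le1.
have VpME : (Vp p w `^ p^-1 = M%:E)%E by rewrite VpE poweR_EFin ME.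
have VqME : (Vcond q rho w `^ q^-1 = (Q `^ q^-1)%:E)%E by rewrite VqE poweR_EFin.
have X0 : 0 <= Q `^ q^-1 by exact: powR_ge0.
split.
- exact: (integrable_D minU lambda_length p1 q1 pq rhoS wfin rhofin mD).
- apply: le_trans VqJ _; rewrite VpME VqME -!EFinM lee_fin.
  by rewrite ler_wpM2r// ler_wpM2r ?(ltW M0)//; lra.
- rewrite /Bnorm VqME supE VpME -EFinD -!EFinM.
  apply: le_trans (leeD (leeD VqJ supJ) VJ) _; rewrite -!EFinD lee_fin.
  rewrite (_ : _ + _ + _ = M * ((3 * c + 1) * Q `^ q^-1 + 8 * S)); last by rewrite KE; ring.
  rewrite [leRHS]mulrAC [leRHS]mulrC ler_wpM2l ?(ltW M0)// mulrDr.
  by apply: lerD; rewrite ler_wpM2r//; lra.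
Qed.
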